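(* Let $d\le 2$. Every GSF-local property $\mathcal{P}\subseteq\mathcal{C}_d$ is non-propagating.
   Context: $\mathcal{C}_d$ is the class of finite simple undirected graphs of maximum degree at most $d$; a property is an isomorphism-closed subset $\mathcal{P}=\bigcup_n\mathcal{P}_n$ of $\mathcal{C}_d$, $\mathcal{P}_n$ its $n$-vertex members. A graph on $n$ vertices is $\epsilon$-close to a set of graphs if at most $\epsilon dn$ edge insertions/deletions turn it into a member of that set on $n$ vertices. For a vertex $v$ of $G$, $N_1^G(v)$ is the set consisting of $v$ and its neighbours. A marked graph is a graph each of whose vertices is marked 'full', 'semifull' or 'partial'. An embedding of a marked graph $F$ into a graph $G$ is an injective map $f:V(F)\to V(G)$ such that for every $v\in V(F)$: if $v$ is full then $N_1^G(f(v))=f(N_1^F(v))$; if $v$ is semifull then $N_1^G(f(v))\cap f(V(F))=f(N_1^F(v))$; if $v$ is partial then $N_1^G(f(v))\supseteq f(N_1^F(v))$. $G$ is $F$-free if there is no embedding of $F$ into $G$, and $\mathcal{F}$-free if it is $F$-free for all $F\in\mathcal{F}$. For a sequence $\overline{\mathcal{F}}=(\mathcal{F}_n)_{n\in\mathbb{N}}$ of sets of marked graphs, $\mathcal{P}$ is $\overline{\mathcal{F}}$-local if there is $s$ such that for every $n$ every graph in $\mathcal{F}_n$ has at most $s$ vertices and $\mathcal{P}_n$ is exactly the set of $n$-vertex graphs that are $\mathcal{F}_n$-free; $\mathcal{P}$ is GSF-local if it is $\overline{\mathcal{F}}$-local for some such sequence. $B\subseteq V(G)$ covers $\mathcal{F}_n$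 in $G$ if every embedding of every $F\in\mathcal{F}_n$ into $G$ maps at least one vertex into $B$. $\overline{\mathcal{F}}$ is non-propagating if there is a monotonically non-decreasing $\tau:(0,1]\to(0,1]$ with (1) for every $\epsilon>0$ some $\beta>0$ has $\tau(\beta)<\epsilon$, and (2) for every graph $G$ on $n$ vertices and every $B\subseteq V(G)$ covering $\mathcal{F}_n$ in $G$, either $G$ is $\tau(|B|/n)$-close to being $\mathcal{F}_n$-free or there are no $n$-vertex $\mathcal{F}_n$-free graphs. A GSF-local property is non-propagating if it is $\overline{\mathcal{F}}$-local for some non-propagating sequence $\overline{\mathcal{F}}$. *)

(* Defs.v *)
From mathcomp Require Import all_boot all_order all_algebra.
From mathcomp Require Import reals.

Set Implicit Arguments.
Unset Strict Implicit.
Unset Printing Implicit Defensive.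

Import Order.TTheory GRing.Theory Num.Theory.
Local Open Scope ring_scope.

Record graph (V : finType) := Graph {
  adj :> rel V;
  adj_sym : symmetric adj;
  adj_irr : irreflexive adj
}.

Definition graph_class := forall V : finType, graph V -> Prop.

Definition isomorphic (V W : finType) (G : graph V) (H : graph W) : Prop :=
  exists2 f : V -> W, bijective f & forall x y, H (f x) (f y) = G x y.

Definition bounded_degree (d : nat) : graph_class :=
  fun V G => forall v : V, (#|[set u | G v u]| <= d)%N.

Definition is_property (d : nat) (P : graph_class) : Prop :=
  (forall (V W : finType) (G : graph V) (H : graph W),
      isomorphic G H -> P V G -> P W H) /\
  (forall (V : finType) (G : graph V), P V G -> bounded_degree d G).

Definition edges (V : finType) (G : graph V) : {set {set V}} :=
  [set e : {set V} | [exists x, exists y, G x y && (e == [set x; y])]].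

(* The least number of edge insertions and deletions turning G into H. *)
Definition edit_distance (V : finType) (G H : graph V) : nat :=
  #|(edges G :\: edges H) :|: (edges H :\: edges G)|.

Definition close_to (R : realType) (d : nat) (eps : R) (Q : graph_class)
    (V : finType) (G : graph V) : Prop :=
  exists2 H : graph V,
    Q V H & (edit_distance G H)%:R <= eps * d%:R * #|V|%:R.

Definition nbhd1 (V : finType) (G : graph V) (v : V) : {set V} :=
  v |: [set u | G v u].

Inductive mark := Full | Semifull | Partial.

Record marked_graph := MarkedGraph {
  mg_vertex : finType;
  mg_graph : graph mg_vertex;
  mg_mark : mg_vertex -> mark
}.

Definition embedding (F : marked_graph) (V : finType) (G : graph V)
    (f : mg_vertex F -> V) : Prop :=
  injective f /\
  forall v : mg_vertex F,
    match mg_mark v with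
    | Full => nbhd1 G (f v) = f @: nbhd1 (mg_graph F) v
    | Semifull =>
        nbhd1 G (f v) :&: f @: [set: mg_vertex F] =
          f @: nbhd1 (mg_graph F) v
    | Partial => f @: nbhd1 (mg_graph F) v \subset nbhd1 G (f v)
    end.

Definition marked_set := marked_graph -> Prop.

(* The ambient universe of graphs is the class of graphs of maximum degree at
   most d, so the class of Fs-free graphs carries the degree bound. *)
Definition free_class (d : nat) (Fs : marked_set) : graph_class :=
  fun V G => bounded_degree d G /\
    forall F, Fs F -> ~ exists f : mg_vertex F -> V, embedding G f.

Definition is_local (d : nat) (Fbar : nat -> marked_set) (P : graph_class)
    : Prop :=
  exists s : nat, forall n : nat,
    (forall F, Fbar n F -> (#|mg_vertex F| <= s)%N) /\
    (forall (V : finType) (G : graph V), #|V| = n ->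
       (P V G <-> free_class d (Fbar n) G)).

Definition GSF_local (d : nat) (P : graph_class) : Prop :=
  exists Fbar : nat -> marked_set, is_local d Fbar P.

Definition covers (Fs : marked_set) (V : finType) (G : graph V)
    (B : {set V}) : Prop :=
  forall F, Fs F -> forall f : mg_vertex F -> V, embedding G f ->
    exists v, f v \in B.

(* tau is constrained only on its domain (0, 1].  The value tau 0 is reached
   only when B is empty (in particular when n = 0); then covering says that
   there is no embedding at all, so G itself is free and the condition is met
   by any choice of tau 0 >= 0. *)
Definition non_propagating_seq (R : realType) (d : nat)
    (Fbar : nat -> marked_set) : Prop :=
  exists tau : R -> R,
    [/\ (forall x, 0 < x <= 1 -> 0 < tau x <= 1),
        (forall x y, 0 < x <= 1 -> 0 < y <= 1 -> x <= y -> tau x <= tau y),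
        (forall eps, 0 < eps -> exists2 beta, 0 < beta <= 1 & tau beta < eps)
      & forall (n : nat) (V : finType) (G : graph V),
          #|V| = n -> bounded_degree d G ->
          forall B : {set V}, covers (Fbar n) G B ->
            close_to d (tau (#|B|%:R / n%:R)) (free_class d (Fbar n)) G \/
            ~ exists (W : finType) (H : graph W),
                #|W| = n /\ free_class d (Fbar n) H].

Definition non_propagating (R : realType) (d : nat) (P : graph_class) : Prop :=
  exists2 Fbar : nat -> marked_set,
    is_local d Fbar P & non_propagating_seq R d Fbar.

(* Main.v *)
Require Import Defs.
From mathcomp Require Import all_boot all_order all_algebra.
From mathcomp Require Import reals.
From mathcomp Require Import boolp zify ring lra.

Set Implicit Arguments.
Unset Strict Implicit.
Unset Printing Implicit Defensive.

(** Replace the given sequence by the largest one with members of bounded size: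
all marked graphs on at most m vertices that embed into no member of P_n. If B
covers this family in G, then every small vertex set of G avoiding B looks like
a vertex set of some member of P_n, and it suffices to modify G near B so that
all small vertex sets of the result still look like that.

A graph of maximum degree 2 is a disjoint union of paths and cycles. Components
meeting B number at most |B|. Suppose first that G has a long path segment
avoiding B: string the components that meet B, together with the component of
the segment, into a single cycle. A small part of a long cycle is a union of
short paths, so it also fits into the segment, and O(|B|) edits suffice.

Otherwise all components avoiding B are short and the others contain O(|B|)
vertices in total. Some X in P_n contains, for each isomorphism type of short
components, as many copies as G has outside B (up to a constant). If X has a
long component, a new long cycle is again harmless. If all components of X are
short, compare the count vectors of component types: trading |Y| copies of a
component Y' against |Y'| copies of Y preserves the number of vertices, so a
vector that is allowed (by comparison with X) and has the right number of
vertices can be moved to within O(|B|) of the vector of G. *)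

(** * Local maps and embeddings of marked graphs *)

(* phi embeds the marked graph induced on U in which the vertices with all
   their neighbours in U are full and the others semifull. *)
Definition local_map (V W : finType) (G : graph V) (X : graph W)
    (U : {set V}) (phi : V -> W) : Prop :=
  [/\ {in U &, injective phi},
      {in U &, forall x y, X (phi x) (phi y) = G x y}
    & {in U, forall x, (forall y, G x y -> y \in U) ->
        forall w, X (phi x) w -> exists2 y, y \in U & w = phi y}].

Lemma local_map_comp (V W Z : finType) (G : graph V) (X : graph W)
    (Y : graph Z) (U : {set V}) (phi : V -> W) (psi : W -> Z) :
  local_map G X U phi -> local_map X Y (phi @: U) psi ->
  local_map G Y U (psi \o phi).
Proof.
move=> [i1 a1 f1] [i2 a2 f2]; split.
- by move=> x y xU yU /= /(i2 _ _ (imset_f _ xU) (imset_f _ yU)); apply: i1.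
- by move=> x y xU yU /=; rewrite a2 ?imset_f// a1.
- move=> x xU fx w /= /f2; case; rewrite ?imset_f//.
    by move=> y /(f1 _ xU fx) [z zU ->]; apply: imset_f.
  by move=> _ /imsetP[y yU ->] ->; exists y.
Qed.

(** A vertex with all its neighbours in [U] is full for [U'] as well. A neighbour of its image
    therefore comes from some [y] in [U']; adjacency is reflected, so [y] is a neighbour and lies in
    [U]. *)
Lemma local_map_sub (V W : finType) (G H : graph V) (X : graph W)
    (U U' : {set V}) (phi : V -> W) :
  U \subset U' -> {in U, forall x, G x =1 H x} ->
  local_map G X U' phi -> local_map H X U phi.
Proof.
move=> /subsetP sU GH [i a f]; split.
- by move=> x y /sU xU /sU yU; apply: i.
- by move=> x y xU yU; rewrite a ?sU// GH.
- move=> x xU fx w Xw.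
  have [|y yU wE] := f _ (sU _ xU) _ _ Xw.
    by move=> y; rewrite GH// => /fx /sU.
  by exists y => //; apply: fx; rewrite -GH// -a ?yU ?(sU x)// -wE.
Qed.

Lemma in_nbhd1 (V : finType) (G : graph V) (v u : V) :
  (u \in nbhd1 G v) = (u == v) || G v u.
Proof. by rewrite !inE. Qed.

(** Semifull and partial vertices only constrain adjacency inside the image of [f], which [phi]
    preserves in both directions. A full vertex has its whole neighbourhood inside that image, and
    this is the case in which [phi] creates no further neighbours. *)
Lemma embedding_local_map (F : marked_graph) (V W : finType) (G : graph V)
    (X : graph W) (f : mg_vertex F -> V) (phi : V -> W) :
  embedding G f -> local_map G X (f @: [set: mg_vertex F]) phi ->
  embedding X (phi \o f).
Proof.
move=> [finj femb] [pinj padj pfull].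
have fU v : f v \in f @: [set: mg_vertex F] by apply: imset_f.
have adjE v u : X (phi (f v)) (phi (f u)) = G (f v) (f u) by rewrite padj.
have eqE v u : (phi (f v) == phi (f u)) = (f v == f u).
  by apply/eqP/eqP => [/(pinj _ _ (fU _) (fU _))|->].
split; first by move=> x y /= /(pinj _ _ (fU _) (fU _)) /finj.
move=> v; have := femb v; case: (mg_mark v) => e.
- apply/setP => w; rewrite in_nbhd1 imset_comp -e.
  apply/idP/imsetP => [/orP[/eqP ->|]|].
  + by exists (f v) => //; rewrite in_nbhd1 eqxx.
  + move=> Xw; have [|y yU wE] := pfull _ (fU v) _ _ Xw.
      move=> y Gy; have : y \in nbhd1 G (f v) by rewrite in_nbhd1 Gy orbT.
      by rewrite e => /imsetP[u _ ->].
    exists y => //; case/imsetP: yU wE => u _ -> wE.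
    by move: Xw; rewrite wE /= adjE in_nbhd1 => ->; rewrite orbT.
  + case=> y; rewrite e => /imsetP[u uN ->] -> /=.
    by rewrite eqE adjE -in_nbhd1 e imset_f.
- apply/setP => w; rewrite inE in_nbhd1 (imset_comp phi f [set: _])
    (imset_comp phi f (nbhd1 _ v)) -e.
  apply/andP/imsetP => [[h /imsetP[y /imsetP[u _ ->] wE]]|].
    exists (f u) => //; move: h; rewrite wE /= eqE adjE inE fU andbT.
    by rewrite in_nbhd1.
  case=> y; rewrite inE => /andP[+ /imsetP[u _ yE]] ->; rewrite yE in_nbhd1.
  by rewrite /= eqE adjE => ->; split => //; apply: imset_f.
- apply/subsetP => w; rewrite imset_comp => /imsetP[y /imsetP[u uN ->] ->].
  have /(subsetP e) : f u \in f @: nbhd1 (mg_graph F) v by apply: imset_f.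
  by rewrite !in_nbhd1 /= eqE adjE.
Qed.

Section InducedMarked.
Variables (V : finType) (G : graph V) (U : {set V}).

Definition induced_adj : rel {x : V | x \in U} :=
  fun x y => G (val x) (val y).

Lemma induced_adj_sym : symmetric induced_adj.
Proof. by move=> x y; apply: adj_sym. Qed.

Lemma induced_adj_irr : irreflexive induced_adj.
Proof. by move=> x; apply: adj_irr. Qed.

(** The strongest marking for which the inclusion of [U] into [G] is an embedding. *)
Definition induced_mark (x : {x : V | x \in U}) : mark :=
  if [set y | G (val x) y] \subset U then Full else Semifull.

Definition induced_marked : marked_graph :=
  @MarkedGraph _ (Graph induced_adj_sym induced_adj_irr) induced_mark.

Lemma induced_marked_embedding : embedding (F := induced_marked) G val.
Proof.
have nE (v : {x | x \in U}) y :
    (y \in [set val u | u in nbhd1 (mg_graph induced_marked) v]) =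
    (y \in nbhd1 G (val v)) && (y \in U).
  rewrite in_nbhd1; apply/imsetP/andP => [[u + ->]|[h yU]].
    by rewrite in_nbhd1 /= => h; split; [exact: h|exact: (valP u)].
  by exists (Sub y yU); rewrite ?SubK// in_nbhd1.
split; first exact: val_inj.
move=> v; rewrite /= /induced_mark; case: ifP => [/subsetP sub|_].
  apply/setP => y; rewrite nE andb_idr// in_nbhd1 => /orP[/eqP ->|Gy].
    exact: valP.
  by apply: sub; rewrite inE.
apply/setP => y; rewrite nE inE; congr (_ && _).
apply/imsetP/idP => [[u _ ->]|yU]; first exact: (valP u).
by exists (Sub y yU).
Qed.

(** Extending [f] by the default [w0] outside [U] turns an embedding of the induced marked graph
    into a local map on [U]. *)
Lemma induced_marked_local_map (W : finType) (X : graph W) (w0 : W)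
    (f : mg_vertex induced_marked -> W) :
  embedding X f -> exists phi, local_map G X U phi.
Proof.
move=> [finj femb].
pose phi x := if insub x is Some u then f u else w0.
have phiE (u : {x | x \in U}) : phi (val u) = f u by rewrite /phi valK.
have nE (v u : {x | x \in U}) :
    (f u \in [set f u | u in nbhd1 (mg_graph induced_marked) v]) =
    (u == v) || G (val v) (val u).
  by rewrite (mem_imset _ _ finj) in_nbhd1.
(* No vertex is marked partial, so non-edges are preserved along with edges. *)
have all u v : X (f u) (f v) = G (val u) (val v).
  have [->|uv] := eqVneq u v; first by rewrite !adj_irr.
  have := femb u; rewrite /= /induced_mark; case: ifP => _ /setP/(_ (f v)).
    rewrite nE in_nbhd1 (inj_eq finj).
    by rewrite eq_sym (negPf uv).
  rewrite inE imset_f// andbT nE in_nbhd1 (inj_eq finj).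
  by rewrite eq_sym (negPf uv).
have inU (Q : V -> Prop) : 
    (forall u : {x | x \in U}, Q (val u)) -> forall x, x \in U -> Q x.
  by move=> h x xU; apply: (h (Sub x xU)).
exists phi; split.
- move=> x y xU yU; move: x xU y yU; apply: (inU) => u; apply: (inU) => v.
  by rewrite !phiE => /finj ->.
- move=> x y xU yU; move: x xU y yU; apply: (inU) => u; apply: (inU) => v.
  by rewrite !phiE.
- apply: (inU) => u fx w; rewrite phiE => Xw.
  have := femb u; rewrite /= /induced_mark; case: ifP => [_|/negP[]]; last first.
    by apply/subsetP => y; rewrite inE; apply: fx.
  move=> /setP/(_ w); rewrite in_nbhd1 Xw orbT => /esym /imsetP[v _ ->].
  by exists (val v); rewrite ?phiE//; apply: valP.
Qed.

End InducedMarked.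

(** * Edit distance through disagreeing pairs *)

Section EditDistance.
Variables (V : finType) (G H : graph V).

Definition disagree : {set V * V} := [set p | G p.1 p.2 != H p.1 p.2].

(** An edited edge is a disagreeing ordered pair in both orders. Splitting the pairs by [enum_rank]
    gives two halves of equal size, each mapping onto the edited edges. *)
Lemma edit_distance_disagree : (2 * edit_distance G H <= #|disagree|)%N.
Proof.
pose lo := [set p in disagree | (enum_rank p.1 < enum_rank p.2)%N].
pose hi := [set p in disagree | (enum_rank p.2 < enum_rank p.1)%N].
pose swap (p : V * V) := (p.2, p.1).
have hiE : #|hi| = #|lo|.
  rewrite -(card_imset (mem lo) (f := swap)); last first.
    by move=> [a b] [c e] [-> ->].
  apply: eq_card => -[a b]; apply/idP/imsetP => [|[[c e]]].
    rewrite !inE /= => /andP[h1 h2]; exists (b, a) => //.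
    by rewrite !inE /= h2 andbT adj_sym [X in _ != X]adj_sym.
  rewrite !inE /= => /andP[h1 h2] [-> ->]; rewrite h2 andbT.
  by rewrite adj_sym [X in _ != X]adj_sym.
have le_lo : (edit_distance G H <= #|lo|)%N.
  apply: leq_trans (leq_imset_card (fun p => [set p.1; p.2]) lo).
  apply/subset_leq_card/subsetP => e eD.
  have [x [y [eE xy]]] : exists x y, e = [set x; y] /\ G x y != H x y.
    have aux (A B : graph V) : e \in edges A :\: edges B ->
        exists x y, e = [set x; y] /\ A x y != B x y.
      rewrite !inE => /andP[nB /existsP[x /existsP[y /andP[Axy /eqP eE]]]].
      exists x, y; split => //; rewrite Axy; apply: contraNneq nB => AB.
      by apply/existsP; exists x; apply/existsP; exists y; rewrite -AB eE eqxx.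
    move: eD; rewrite in_setU => /orP[/aux //|/aux [x [y [? ?]]]].
    by exists x, y; rewrite eq_sym.
  have [h|h|h] := ltngtP (enum_rank x) (enum_rank y).
  - by apply/imsetP; exists (x, y); rewrite ?inE ?xy ?h.
  - apply/imsetP; exists (y, x); rewrite ?inE /= ?h ?andbT.
      by rewrite adj_sym [X in _ != X]adj_sym.
    by rewrite eE setUC.
  - by move: xy; rewrite (enum_rank_inj (val_inj h)) !adj_irr.
have : (#|lo| + #|hi| <= #|disagree|)%N.
  rewrite -cardsUI; have -> : lo :&: hi = set0.
    by apply/setP => p; rewrite !inE; lia.
  rewrite cards0 addn0; apply/subset_leq_card/subsetP => p.
  by rewrite !inE => /orP[/andP[]|/andP[]].
by rewrite hiE; lia.
Qed.

(** Disagreements start only at vertices of [A], at most [2 * d] at each: [d] neighbours in either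
    graph. Halving gives the bound. *)
Lemma edit_distance_le (d : nat) (A : {set V}) :
  bounded_degree d G -> bounded_degree d H ->
  (forall x y, x \notin A -> G x y = H x y) ->
  (edit_distance G H <= d * #|A|)%N.
Proof.
move=> dG dH agree.
rewrite -(leq_pmul2l (m := 2))//; apply: leq_trans edit_distance_disagree _.
have -> : #|disagree| = \sum_x #|[set y | G x y != H x y]|.
  rewrite -sum1_card
    (eq_bigl (fun p : V * V => true && (G p.1 p.2 != H p.1 p.2))); last first.
    by move=> p; rewrite inE.
  rewrite -(pair_big_dep xpredT (fun x y => G x y != H x y) (fun _ _ => 1)) /=.
  by apply: eq_bigr => x _; rewrite -sum1_card; apply: eq_bigl => y; rewrite inE.
rewrite (bigID (mem A)) /= [X in _ + X]big1 ?addn0; last first.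
  move=> x xA; apply/eqP; rewrite cards_eq0; apply/eqP/setP => y.
  by rewrite !inE agree// eqxx.
apply: (@leq_trans (\sum_(x in A) 2 * d)); last by rewrite sum_nat_const; lia.
apply: leq_sum => x _.
apply: (@leq_trans #|[set y | G x y] :|: [set y | H x y]|).
  apply/subset_leq_card/subsetP => y; rewrite !inE.
  by case: (G x y); case: (H x y).
rewrite cardsU; have := dG x; have := dH x; lia.
Qed.

End EditDistance.

(** * Covering and membership in terms of local maps *)

Section Transfer.
Variables (d : nat) (P : graph_class) (hP : is_property d P).
Variable (n : nat).

Definition unrealised (m : nat) : marked_set := fun F =>
  (#|mg_vertex F| <= m)%N /\
  forall (W : finType) (X : graph W), #|W| = n -> P X ->
    ~ exists f : mg_vertex F -> W, embedding X f.

(** Otherwise the marked graph induced on [U] embeds into no member, so it belongs to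
    [unrealised m], and its inclusion into [G] would have to meet [B]. *)
Lemma covers_local_map m (V : finType) (G : graph V) (B U : {set V}) :
  #|V| = n -> (0 < n)%N -> covers (unrealised m) G B ->
  (#|U| <= m)%N -> [disjoint U & B] ->
  exists (W : finType) (X : graph W) (phi : V -> W),
    [/\ #|W| = n, P X & local_map G X U phi].
Proof.
move=> Vn n0 cov Um dUB; apply: contrapT => no.
have [|u uB] := cov (induced_marked G U) _ _ (induced_marked_embedding G U).
  split; first by rewrite /= card_sig.
  move=> W X Wn PX [f femb]; apply: no.
  have /card_gt0P[w0 _] : (0 < #|W|)%N by rewrite Wn.
  by have [phi] := induced_marked_local_map w0 femb; exists W, X, phi.
by have /pred0P/(_ (val u)) := dUB; rewrite /= uB (valP u).
Qed.

(** A forbidden embedding into [H] would be carried into a member. The degree bound is local too: a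
    violation shows on a vertex with [d.+1] of its neighbours, which is why [s] is at least
    [d.+2]. *)
Lemma local_maps_property s (Fs : marked_set) (V : finType) (H : graph V) :
  #|V| = n -> (d.+2 <= s)%N ->
  (forall F, Fs F -> (#|mg_vertex F| <= s)%N) ->
  (forall (W : finType) (X : graph W), #|W| = n ->
     (P X <-> free_class d Fs X)) ->
  (forall U : {set V}, (#|U| <= s)%N ->
    exists (W : finType) (X : graph W) (phi : V -> W),
    [/\ #|W| = n, P X & local_map H X U phi]) ->
  P H.
Proof.
move=> Vn ds Fsize Ploc loc; apply/Ploc => //; split.
  move=> v; rewrite leqNgt; apply/negP => dv.
  have : exists2 A : {set V}, A \subset [set u | H v u] & #|A| = d.+1.
    have /card_geqP[t [tu ts tA]] := dv; exists [set x in t].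
      by apply/subsetP => x; rewrite inE => /tA.
    by rewrite cardsE (card_uniqP tu).
  case=> A /subsetP Av Ad.
  have [|W [X [phi [Wn PX [pinj padj _]]]]] := loc (v |: A).
    by rewrite cardsU1 Ad; apply: leq_trans ds; case: (_ \notin _); lia.
  have := (hP.2 _ _ PX) (phi v); rewrite leqNgt => /negP; apply.
  rewrite -Ad -(card_in_imset (f := phi) (D := A)); last first.
    by move=> x y xA yA; apply: pinj; rewrite in_setU1 ?xA ?yA orbT.
  apply/subset_leq_card/subsetP => _ /imsetP[x xA ->].
  rewrite inE padj ?in_setU1 ?xA ?eqxx ?orbT//.
  by have := Av x xA; rewrite inE.
move=> F FsF [f femb].
have [|W [X [phi [Wn PX loc_phi]]]] := loc (f @: [set: _]).
  by apply: leq_trans (leq_imset_card _ _) _; rewrite cardsT Fsize.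
have [_ /(_ F FsF)] := (Ploc _ _ Wn).1 PX; apply.
by exists (phi \o f); apply: embedding_local_map femb loc_phi.
Qed.

End Transfer.

(** * Path and cycle layouts *)

Definition index_adj (b : bool) (m i j : nat) : bool :=
  [|| i.+1 == j, j.+1 == i |
      b && ((i == 0) && (j.+1 == m) || (j == 0) && (i.+1 == m))].

(* A component is a pair (b, p): the cycle (b = true) or path (b = false)
   through the vertices of p in this order.  A "cycle" on at most two vertices
   is the same graph as the path on them. *)
Definition comp_adj (V : eqType) (c : bool * seq V) (x y : V) : bool :=
  [&& x \in c.2, y \in c.2, x != y &
      index_adj c.1 (size c.2) (index x c.2) (index y c.2)].

Definition vertices (V : Type) (l : seq (bool * seq V)) : seq V :=
  flatten [seq c.2 | c <- l].

Definition layout_adj (V : eqType) (l : seq (bool * seq V)) (x y : V) : bool :=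
  has (fun c => comp_adj c x y) l.

Lemma index_adj_sym b m : symmetric (index_adj b m).
Proof. by move=> i j; rewrite /index_adj; lia. Qed.

Lemma comp_adj_sym (V : eqType) (c : bool * seq V) : symmetric (comp_adj c).
Proof.
by move=> x y; rewrite /comp_adj index_adj_sym eq_sym andbCA.
Qed.

Lemma layout_adj_sym (V : eqType) (l : seq (bool * seq V)) :
  symmetric (layout_adj l).
Proof. by move=> x y; apply: eq_has => c; apply: comp_adj_sym. Qed.

Lemma layout_adj_irr (V : eqType) (l : seq (bool * seq V)) :
  irreflexive (layout_adj l).
Proof. by move=> x; apply/hasP => -[c _]; rewrite /comp_adj eqxx !andbF. Qed.

Definition layout_graph (V : finType) (l : seq (bool * seq V)) : graph V :=
  Graph (layout_adj_sym l) (layout_adj_irr l).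

(** The last clause compares adjacency with every vertex of [V], so listed vertices have no
    neighbours outside the list: [l] consists of entire components of [G]. *)
Definition partial_layout (V : finType) (G : graph V)
    (l : seq (bool * seq V)) : Prop :=
  [/\ all (fun c => 0 < size c.2) l, uniq (vertices l)
    & {in vertices l, forall x, G x =1 layout_adj l x}].

Lemma verticesP (V : eqType) (l : seq (bool * seq V)) x :
  reflect (exists2 c, c \in l & x \in c.2) (x \in vertices l).
Proof. exact: flatten_mapP. Qed.

Lemma vertices_cat (V : Type) (l1 l2 : seq (bool * seq V)) :
  vertices (l1 ++ l2) = vertices l1 ++ vertices l2.
Proof. by rewrite /vertices map_cat flatten_cat. Qed.

Lemma vertices_cons (V : Type) c (l : seq (bool * seq V)) :
  vertices (c :: l) = c.2 ++ vertices l.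
Proof. by []. Qed.

Lemma perm_vertices (V : eqType) (l1 l2 : seq (bool * seq V)) :
  perm_eq l1 l2 -> perm_eq (vertices l1) (vertices l2).
Proof. by move=> l12; apply: perm_flatten; apply: perm_map. Qed.

Lemma layout_adj_vertices (V : eqType) (l : seq (bool * seq V)) x y :
  layout_adj l x y -> (x \in vertices l) && (y \in vertices l).
Proof.
case/hasP => c cl /and3P[xc yc _].
by apply/andP; split; apply/verticesP; exists c.
Qed.

Lemma layout_adj_cat (V : eqType) (l1 l2 : seq (bool * seq V)) x y :
  layout_adj (l1 ++ l2) x y = layout_adj l1 x y || layout_adj l2 x y.
Proof. exact: has_cat. Qed.

Lemma layout_adj_catl (V : eqType) (l1 l2 : seq (bool * seq V)) x y :
  uniq (vertices (l1 ++ l2)) -> x \in vertices l1 ->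
  layout_adj (l1 ++ l2) x y = layout_adj l1 x y.
Proof.
rewrite vertices_cat cat_uniq => /and3P[_ /hasPn dis _] xl.
rewrite layout_adj_cat orbC; case: (boolP (layout_adj l2 x y)) => //.
by move=> /layout_adj_vertices/andP[/dis]; rewrite xl.
Qed.

Lemma perm_layout_adj (V : eqType) (l1 l2 : seq (bool * seq V)) x y :
  perm_eq l1 l2 -> layout_adj l1 x y = layout_adj l2 x y.
Proof. by move=> /perm_mem l12; apply: eq_has_r. Qed.

Lemma perm_partial_layout (V : finType) (G : graph V) l1 l2 :
  perm_eq l1 l2 -> partial_layout G l1 -> partial_layout G l2.
Proof.
move=> l12 [ne un adj]; split.
- by rewrite -(perm_all _ l12).
- by rewrite -(perm_uniq (perm_vertices l12)).
- move=> x; rewrite -(perm_mem (perm_vertices l12)) => xl y.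
  by rewrite adj// (perm_layout_adj _ _ l12).
Qed.

Lemma partial_layout_catl (V : finType) (G : graph V) l1 l2 :
  partial_layout G (l1 ++ l2) -> partial_layout G l1.
Proof.
move=> [+ un adj]; rewrite all_cat => /andP[ne1 _]; split => //.
  by move: un; rewrite vertices_cat cat_uniq => /andP[].
move=> x xl y; rewrite adj; first by rewrite layout_adj_catl.
by rewrite vertices_cat mem_cat xl.
Qed.

Lemma partial_layout_filter (V : finType) (G : graph V) l (p : pred _) :
  partial_layout G l -> partial_layout G (filter p l).
Proof.
move=> Gl; apply: (@partial_layout_catl _ _ _ (filter (predC p) l)).
by apply: perm_partial_layout Gl; rewrite perm_sym; apply/permPl/perm_filterC.
Qed.

Lemma partial_layout_subseq (V : finType) (G : graph V) l l' :
  subseq l' l -> partial_layout G l -> partial_layout G l'.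
Proof.
move=> /perm_to_subseq[l2 ll] Gl.
by apply: (@partial_layout_catl _ _ _ l2); apply: perm_partial_layout Gl.
Qed.

Lemma layout_graph_partial_layout (V : finType) (l : seq (bool * seq V)) :
  all (fun c => 0 < size c.2) l -> uniq (vertices l) ->
  partial_layout (layout_graph l) l.
Proof. by move=> ne un; split. Qed.

Lemma layout_adj_comp (V : eqType) (l : seq (bool * seq V)) c x y :
  uniq (vertices l) -> c \in l -> x \in c.2 ->
  layout_adj l x y = comp_adj c x y.
Proof.
move=> un cl xc; have lE := perm_to_rem cl.
rewrite (perm_layout_adj _ _ lE) -cat1s layout_adj_catl.
- by rewrite /layout_adj /= orbF.
- by rewrite cat1s -(perm_uniq (perm_vertices lE)).
- by rewrite /vertices /= cats0.
Qed.

Lemma partial_layout_comp (V : finType) (G : graph V) l c x y :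
  partial_layout G l -> c \in l -> x \in c.2 -> G x y = comp_adj c x y.
Proof.
move=> [_ un adj] cl xc; rewrite adj; last by apply/verticesP; exists c.
exact: layout_adj_comp.
Qed.

(** At an inner position the wrap-around clause is false, so paths and cycles look the same
    there. *)
Lemma comp_adj_inner (V : eqType) b (l r : seq V) u x w y :
  uniq (l ++ [:: u, x, w & r]) ->
  comp_adj (b, l ++ [:: u, x, w & r]) x y = (y == u) || (y == w).
Proof.
move=> un; set p := l ++ _ in un *.
have pn i : i < size p -> index (nth x p i) p = i by move=> ?; rewrite index_uniq.
have sp : size p = (size l + (size r).+3)%N by rewrite size_cat.
have nu : nth x p (size l) = u by rewrite nth_cat ltnn subnn.
have nx : nth x p (size l).+1 = x.
  by rewrite nth_cat ifN ?subSn ?subnn//; lia.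
have nw : nth x p (size l).+2 = w.
  by rewrite nth_cat ifN ?subSn ?subnn//; lia.
have iu : index u p = size l by rewrite -nu pn// sp; lia.
have ix : index x p = (size l).+1 by rewrite -[X in index X _]nx pn// sp; lia.
have iw : index w p = (size l).+2 by rewrite -nw pn// sp; lia.
have xp : x \in p by rewrite -index_mem ix sp; lia.
have up : u \in p by rewrite -index_mem iu sp; lia.
have wp : w \in p by rewrite -index_mem iw sp; lia.
rewrite /comp_adj /= xp ix /=.
have [yp|yp] /= := boolP (y \in p); last first.
  by apply/esym/negbTE; rewrite negb_or; apply/andP; split; apply: contraNneq yp => ->.
have eqi v : v \in p -> (y == v) = (index y p == index v p).
  move=> vp; apply/eqP/eqP => [->//|h].
  by rewrite -(nth_index x yp) h nth_index.
rewrite (eqi u)// (eqi w)// eq_sym (eqi x)// iu ix iw /index_adj sp.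
by move: (index y p) => k; lia.
Qed.

Lemma degree2_adj (V : finType) (G : graph V) x u w y :
  bounded_degree 2 G -> G x u -> G x w -> u != w -> G x y ->
  (y == u) || (y == w).
Proof.
move=> dG xu xw uw xy; apply/negPn/negP; rewrite negb_or => /andP[yu yw].
have : #|y |: [set u; w]| <= 2.
  apply: leq_trans (dG x); apply/subset_leq_card/subsetP => z.
  by rewrite !inE => /or3P[] /eqP ->.
by rewrite cardsU1 cards2 !inE negb_or yu yw uw.
Qed.

Lemma uniq_size_bound (V : finType) :
  exists N, forall q : seq V, uniq q -> size q <= N.
Proof. by exists #|V| => q uq; rewrite -(card_uniqP uq) max_card. Qed.

(** * Graphs of maximum degree two as unions of paths and cycles *)

Section Layout.
Variables (V : finType) (G : graph V) (dG : bounded_degree 2 G).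

(** The path is extended at either end while possible; [A] is closed under adjacency, so it never
    leaves [A], and the room [N - size p] shrinks. *)
Lemma maximal_path (A : {set V}) (p : seq V) (x0 : V) :
  (forall x y, x \in A -> G x y -> y \in A) ->
  0 < size p -> uniq p -> all (mem A) p -> sorted G p ->
  exists q, [/\ 0 < size q, uniq q, all (mem A) q, sorted G q
    & (forall y, G (head x0 q) y -> y \in q) /\
      (forall y, G (last x0 q) y -> y \in q)].
Proof.
have [N card] := uniq_size_bound V.
move=> clA; have [k] := ubnP (N - size p).
elim: k p => // k IH p pk p0 up pA sp.
have [/existsP[y /andP[hy yp]]|/existsPn nh] :=
    boolP [exists y, G (head x0 p) y && (y \notin p)].
  have uyp : uniq (y :: p) by rewrite /= yp.
  apply: (IH (y :: p)) => //=.
  - by have := card _ uyp; rewrite /=; lia.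
  - rewrite pA andbT; case: p p0 pA hy {pk up sp yp uyp} => //= z p _ /andP[zA _].
    by apply: clA.
  - case: p p0 sp hy {pk up pA yp uyp} => //= z p _ -> h.
    by rewrite adj_sym h.
have [/existsP[y /andP[hy yp]]|/existsPn nl] :=
    boolP [exists y, G (last x0 p) y && (y \notin p)].
  have uyp : uniq (rcons p y) by rewrite rcons_uniq yp.
  apply: (IH (rcons p y)) => //=.
  - by have := card _ uyp; rewrite size_rcons; lia.
  - by rewrite size_rcons.
  - rewrite all_rcons pA andbT.
    have := clA (last x0 p) y _ hy; apply; apply: (allP pA).
    by case: p p0 {pk up pA sp hy yp uyp nh} => //= z p _; apply: mem_last.
  - by case: p p0 sp hy {pk up pA yp uyp nh} => //= z p _ h1 h2; rewrite rcons_path h1.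
exists p; split => //; split => y hy.
- by have := nh y; rewrite hy /= negbK.
- by have := nl y; rewrite hy /= negbK.
Qed.

(** Inner vertices already have their two neighbours on the path, and the ends have none outside it.
    The only further edge possible joins the two ends, and [b] records whether it is present. *)
Lemma component_layout (p : seq V) (x0 : V) :
  0 < size p -> uniq p -> sorted G p ->
  (forall y, G (head x0 p) y -> y \in p) ->
  (forall y, G (last x0 p) y -> y \in p) ->
  exists b, forall x y, x \in p -> G x y = comp_adj (b, p) x y.
Proof.
move=> p0 up sp hd lt.
exists (G (head x0 p) (last x0 p)) => x y xp.
pose v := nth x0 p; pose m := size p.
have consec i : i.+1 < m -> G (v i) (v i.+1) by move=> im; apply: (sortedP x0 sp).
have vi z : z \in p -> v (index z p) = z by apply: nth_index.
have iv i : i < m -> index (v i) p = i by move=> im; rewrite index_uniq.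
have im z : z \in p -> index z p < m by rewrite index_mem.
have vp i : i < m -> v i \in p by apply: mem_nth.
have h0 : head x0 p = v 0 by rewrite /v nth0.
have hl : last x0 p = v m.-1 by rewrite /v /m nth_last.
have inner i y' : 0 < i -> i.+1 < m -> G (v i) y' ->
    y' \in p /\ index_adj false m i (index y' p).
  move=> i0 i1 Gy.
  have /orP[] : (y' == v i.-1) || (y' == v i.+1).
    apply: degree2_adj Gy => //.
    - by rewrite adj_sym -{2}(prednK i0); apply: consec; rewrite prednK//; lia.
    - exact: consec.
    - by rewrite nth_uniq//; rewrite -/m; lia.
  - by move=> /eqP ->; rewrite iv ?vp /index_adj //; lia.
  - by move=> /eqP ->; rewrite iv ?vp /index_adj //; lia.
apply/idP/idP => [Gxy|].
  have yp : y \in p.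
    have [i0|i0] := posnP (index x p).
      by apply: hd; rewrite h0 -i0 vi.
    have [i1|i1] := ltnP (index x p).+1 m.
      by have [|//] := inner (index x p) y i0 i1; rewrite vi.
    by apply: lt; rewrite hl (_ : m.-1 = index x p) ?vi//; have := im x xp; lia.
  have xy : x != y by apply: contraTneq Gxy => ->; rewrite adj_irr.
  rewrite /comp_adj /= xp yp xy /=.
  have adjF b i j : index_adj false m i j -> index_adj b m i j.
    by rewrite /index_adj; lia.
  have ixy : index x p != index y p.
    by apply: contraNneq xy => h; rewrite -(vi x)// -(vi y)// h.
  have := im _ xp; have := im _ yp => jm ixm.
  have [i0|i0] := boolP ((0 < index x p) && ((index x p).+1 < m)).
    case/andP: i0 => i0 i1; apply: adjF; apply: (inner _ _ i0 i1 _).2.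
    by rewrite vi.
  have [j0|j0] := boolP ((0 < index y p) && ((index y p).+1 < m)).
    case/andP: j0 => j0 j1; rewrite index_adj_sym.
    apply: adjF; apply: (inner _ _ j0 j1 _).2.
    by rewrite vi// adj_sym.
  have -> : G (head x0 p) (last x0 p).
    rewrite h0 hl.
    have [[i j]|[i j]] : (index x p = 0 /\ index y p = m.-1) \/
                         (index y p = 0 /\ index x p = m.-1) by lia.
      by rewrite -i -j !vi.
    by rewrite -i -j !vi// adj_sym.
  by rewrite /index_adj; rewrite -/m; lia.
rewrite /comp_adj /= => /and4P[_ yp xy]; have := im _ yp; have := im _ xp.
have -> : G x y = G (v (index x p)) (v (index y p)) by rewrite !vi.
move: (index x p) (index y p) => i j ixm jm.
case/or3P => [/eqP h|/eqP h|
  /andP[Gb /orP[/andP[/eqP i0 /eqP j1]|/andP[/eqP i0 /eqP j1]]]].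
- by rewrite -h; apply: consec; rewrite h.
- by rewrite adj_sym -h; apply: consec; rewrite h.
- by rewrite i0 (_ : j = m.-1) -?hl -?h0// /m -j1.
- by rewrite adj_sym i0 (_ : i = m.-1) -?hl -?h0// /m -j1.
Qed.

(** The vertices not yet listed are closed under adjacency, so a maximal path among them spans a
    whole component, which is appended. *)
Lemma layout_extend (l : seq (bool * seq V)) :
  partial_layout G l ->
  exists l', partial_layout G (l ++ l') /\ forall x, x \in vertices (l ++ l').
Proof.
have [N card] := uniq_size_bound V.
have [k] := ubnP (N - size (vertices l)).
elim: k l => // k IH l lk Gl.
have [all_in|] := boolP [forall x, x \in vertices l].
  by exists [::]; rewrite cats0; split => // x; apply: (forallP all_in).
rewrite negb_forall => /existsP[x0 x0l].
have [ne un adj] := Gl.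
pose A := [set x | x \notin vertices l].
have clA x y : x \in A -> G x y -> y \in A.
  rewrite !inE => xA Gxy; apply: contra xA => yl.
  move: Gxy; rewrite adj_sym adj// => /layout_adj_vertices/andP[_].
  by [].
have [||||p [p0 up pA sp [hd lt]]] := @maximal_path A [:: x0] x0 clA => //.
  by rewrite /= inE x0l.
have [b bE] := component_layout p0 up sp hd lt.
have Gl' : partial_layout G (l ++ [:: (b, p)]).
  have u' : uniq (vertices (l ++ [:: (b, p)])).
    rewrite vertices_cat cat_uniq un /vertices /= cats0 up andbT.
    apply/hasPn => x xp; by move: (allP pA x xp); rewrite /= inE.
  split => //.
  - by rewrite all_cat ne /= p0.
  - move=> x; rewrite vertices_cat mem_cat => /orP[xl|].
      by move=> y; rewrite layout_adj_catl// adj.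
    rewrite /vertices /= cats0 => xp y.
    rewrite (@layout_adj_comp _ _ (b, p))// ?mem_cat ?inE ?eqxx ?orbT//.
    exact: bE.
have [|l' [Gl'' cov]] := IH (l ++ [:: (b, p)]) _ Gl'.
  have : size (vertices (l ++ [:: (b, p)])) <= N by case: Gl' => _ /card.
  rewrite vertices_cat size_cat [vertices [:: _]]cats0.
  by move: lk p0; rewrite /=; move: (size (vertices l)) (size p) => i j; lia.
by exists ((b, p) :: l'); rewrite -cat1s catA.
Qed.

End Layout.

(** * Matching components of equal shape *)

Definition comp_shape (V : Type) (c : bool * seq V) : bool * nat :=
  (c.1, size c.2).

Lemma comp_adj_mem (V : eqType) (c : bool * seq V) x y :
  comp_adj c x y -> (x \in c.2) && (y \in c.2).
Proof. by case/and4P => -> ->. Qed.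

Lemma comp_adj_nth (V W : eqType) (b : bool) (p : seq V) (q : seq W) w0 x y :
  uniq q -> size p = size q -> x \in p -> y \in p ->
  comp_adj (b, q) (nth w0 q (index x p)) (nth w0 q (index y p)) =
  comp_adj (b, p) x y.
Proof.
move=> uq spq xp yp.
have ix : index x p < size q by rewrite -spq index_mem.
have iy : index y p < size q by rewrite -spq index_mem.
rewrite /comp_adj /= !mem_nth// xp yp /= !index_uniq// nth_uniq// spq.
congr (~~ _ && _); apply/eqP/eqP => [h|->//].
by rewrite -(nth_index x xp) h nth_index.
Qed.

Lemma match_layouts (V W : finType) (G : graph V) (X : graph W) l l' (w0 : W) :
  partial_layout G l -> partial_layout X l' ->
  (forall t, count_mem t (map (@comp_shape _) l) <=
             count_mem t (map (@comp_shape _) l')) ->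
  exists phi, local_map G X [set x in vertices l] phi /\
    {in vertices l, forall x, phi x \in vertices l'}.
Proof.
elim: l l' => [|c l IH] l' Gl Xl' cnt.
  by exists (fun => w0); split => //; split=> x //; rewrite ?inE.
have /mapP[c' c'l [cb cs]] : comp_shape c \in map (@comp_shape _) l'.
  by rewrite -has_pred1 has_count; apply: leq_trans (cnt _); rewrite /= eqxx.
have lE := perm_to_rem c'l; set l'' := rem c' l' in lE.
have {}Xl' := perm_partial_layout lE Xl'.
have [|||phi [[pinj padj pfull] pim]] := IH l''.
- by apply: partial_layout_subseq Gl; apply: subseq_cons.
- by apply: partial_layout_subseq Xl'; apply: subseq_cons.
- move=> t; have := cnt t.
  rewrite (permP (perm_map (@comp_shape _) lE)) /= /comp_shape -cb -cs.
  by rewrite leq_add2l.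
have [_ uG aG] := Gl; have [_ uX aX] := Xl'.
pose f x := if x \in c.2 then nth w0 c'.2 (index x c.2) else phi x.
have fc x : x \in c.2 -> f x = nth w0 c'.2 (index x c.2) by rewrite /f => ->.
have fc' x : x \in c.2 -> f x \in c'.2.
  by move=> xc; rewrite fc// mem_nth// -cs index_mem.
have fl x : x \in vertices l -> (x \notin c.2) && (f x == phi x).
  move: uG; rewrite vertices_cons cat_uniq => /and3P[_ /hasPn h _] xl.
  by rewrite /f (negPf (h _ xl)) eqxx.
have fl' x : x \in vertices l -> (f x \notin c'.2) && (f x \in vertices l'').
  move: uX; rewrite vertices_cons cat_uniq => /and3P[_ /hasPn h _] xl.
  have /andP[_ /eqP ->] := fl x xl.
  by rewrite (pim x xl) andbT; apply: h; apply: pim.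
have ucc' : uniq c'.2.
  by move: uX; rewrite vertices_cons cat_uniq => /and3P[].
have Gc x y : x \in c.2 -> G x y = comp_adj c x y.
  by move=> xc; apply: (partial_layout_comp _ Gl) => //; rewrite mem_head.
have Xc x y : x \in c'.2 -> X x y = comp_adj c' x y.
  by move=> xc; apply: (partial_layout_comp _ Xl') => //; rewrite mem_head.
have cl x : x \in vertices (c :: l) -> x \in c.2 \/ x \in vertices l.
  by rewrite vertices_cons mem_cat => /orP.
have mix x y : x \in c.2 -> y \in vertices l -> X (f x) (f y) = G x y.
  move=> xc yl; rewrite Gc// Xc ?fc'//.
  have /andP[yc _] := fl y yl; have /andP[fyc _] := fl' y yl.
  rewrite [LHS]negbTE ?[RHS]negbTE//.
    by apply: contra yc => /comp_adj_mem/andP[].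
  by apply: contra fyc => /comp_adj_mem/andP[].
have lset x : (x \in [set x in vertices l]) = (x \in vertices l) by rewrite inE.
exists f; split; last first.
  move=> x /cl; rewrite (perm_mem (perm_vertices lE)) vertices_cons mem_cat.
  by case=> [/fc' -> //|/fl' /andP[_ ->]]; rewrite orbT.
split.
- move=> x y; rewrite !inE => /cl[xc|xl] /cl[yc|yl].
  + rewrite !fc// => /eqP; rewrite nth_uniq -?cs ?index_mem// => /eqP h.
    by rewrite -(nth_index x xc) h nth_index.
  + by move=> h; have := fl' y yl; rewrite -h fc'.
  + by move=> h; have := fl' x xl; rewrite h fc'.
  + have /andP[_ /eqP ->] := fl x xl; have /andP[_ /eqP ->] := fl y yl.
    by apply: pinj; rewrite lset.
- move=> x y; rewrite !inE => /cl[xc|xl] /cl[yc|yl].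
  + rewrite Gc// Xc ?fc'// !fc//.
    have := @comp_adj_nth _ _ c.1 c.2 c'.2 w0 x y ucc' cs xc yc.
    by rewrite {1}cb -!surjective_pairing.
  + exact: mix.
  + by rewrite adj_sym mix// adj_sym.
  + have /andP[_ /eqP ->] := fl x xl; have /andP[_ /eqP ->] := fl y yl.
    by apply: padj; rewrite lset.
- move=> x; rewrite inE => /cl[xc|xl] _ w.
    rewrite Xc ?fc'// => /comp_adj_mem/andP[_ wc].
    have wi : index w c'.2 < size c.2 by rewrite cs index_mem.
    have yc : nth x c.2 (index w c'.2) \in c.2 by apply: mem_nth.
    exists (nth x c.2 (index w c'.2)).
      by rewrite inE vertices_cons mem_cat yc.
    rewrite fc// index_uniq ?nth_index//.
    by move: uG; rewrite vertices_cons cat_uniq => /and3P[].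
  have /andP[_ /eqP ->] := fl x xl => Xw.
  have [|y|y yl ->] := pfull x _ _ w Xw; rewrite ?lset//.
    have [_ _ al] : partial_layout G l.
      by apply: partial_layout_subseq Gl; apply: subseq_cons.
    by rewrite al// => /layout_adj_vertices/andP[].
  move: yl; rewrite lset => yl; exists y.
    by rewrite inE vertices_cons mem_cat yl orbT.
  by have /andP[_ /eqP ->] := fl y yl.
Qed.

(** All neighbours of a listed vertex are listed, so every vertex is full and the image of a
    component is again an entire component. *)
Lemma map_layout (V W : finType) (G : graph V) (X : graph W) l phi :
  partial_layout G l -> local_map G X [set x in vertices l] phi ->
  partial_layout X [seq (c.1, map phi c.2) | c <- l].
Proof.
move=> [ne un adj] [pinj padj pfull].
have suppE (k : seq (bool * seq V)) :
    vertices [seq (c.1, map phi c.2) | c <- k] = map phi (vertices k).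
  by rewrite /vertices -map_comp map_flatten -map_comp.
have {}pinj : {in vertices l &, injective phi}.
  by move=> x y xl yl; apply: pinj; rewrite inE.
have ux : uniq (vertices [seq (c.1, map phi c.2) | c <- l]).
  by rewrite suppE map_inj_in_uniq.
split => //.
  by rewrite all_map; apply: sub_all ne => c /=; rewrite size_map.
move=> w; rewrite suppE => /mapP[x xl ->] w'.
have [c cl xc] := verticesP _ _ xl.
have uc : uniq c.2.
  move: un; rewrite (perm_uniq (perm_vertices (perm_to_rem cl))).
  by rewrite vertices_cons cat_uniq => /and3P[].
rewrite (@layout_adj_comp _ _ (c.1, map phi c.2))//; last 2 first.
  by apply/mapP; exists c.
  exact: map_f.
have sub z : z \in c.2 -> z \in vertices l by move=> zc; apply/verticesP; exists c.
have um : uniq (map phi c.2).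
  by rewrite map_inj_in_uniq// => a b ac bc; apply: pinj; apply: sub.
have cE y : y \in c.2 ->
    X (phi x) (phi y) = comp_adj (c.1, map phi c.2) (phi x) (phi y).
  move=> yc; rewrite padj ?inE ?sub// adj// (layout_adj_comp _ un cl)//.
  have nE z : z \in c.2 -> phi z = nth (phi x) (map phi c.2) (index z c.2).
    by move=> zc; rewrite (nth_map x) ?index_mem// nth_index.
  have := @comp_adj_nth _ _ c.1 c.2 (map phi c.2) (phi x) x y um _ xc yc.
  by rewrite -!nE// size_map -surjective_pairing => ->.
apply/idP/idP.
  move=> Xw; have [||y yl wE] := pfull x _ _ w' Xw; rewrite ?inE//.
    by move=> y; rewrite inE adj// => /layout_adj_vertices/andP[].
  move: yl; rewrite inE => yl; rewrite wE -cE -?wE//.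
  move: Xw; rewrite wE padj ?inE// adj// (layout_adj_comp _ un cl)//.
  by move=> /comp_adj_mem/andP[].
move=> h; have /andP[_ /mapP[y yc yE]] := comp_adj_mem h.
by move: h; rewrite yE -cE.
Qed.

(** * Counting components by shape *)

(** Serves twice: with the constant cap [s] to take a bounded sample of the components, and with a
    target vector as cap to select the components left unchanged. *)
Lemma capped_subseq (T S : eqType) (f : T -> S) (cap : S -> nat) (k : seq T) :
  exists2 k', subseq k' k & forall t,
    count_mem t (map f k') = minn (cap t) (count_mem t (map f k)).
Proof.
elim: k => [|c k [k' sk cnt]]; first by exists [::] => // t; rewrite minn0.
have [lt|ge] := ltnP (count_mem (f c) (map f k)) (cap (f c)).
  exists (c :: k'); first by rewrite /= eqxx.
  by move=> t /=; rewrite cnt; case: eqP lt => [->|_]; lia.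
exists k'; first by apply: subseq_trans sk (subseq_cons _ _).
by move=> t /=; rewrite cnt; case: eqP ge => [->|_]; lia.
Qed.

Lemma sum_mul_indicator (T : finType) (sz : T -> nat) (i : T) c :
  \sum_t sz t * ((t == i) * c) = sz i * c.
Proof.
rewrite (bigD1 i)//= eqxx mul1n big1 ?addn0// => t /negPf ->.
by rewrite mul0n muln0.
Qed.

(* Vectors with the same weighted sum as h0 are moved towards g by trading
   sz j units of i for sz i units of j, which keeps the weighted sum. *)
Lemma close_vector (T : finType) (sz : T -> nat) (M s r : nat)
    (g h0 : T -> nat) :
  (forall t, 0 < sz t <= M) ->
  \sum_t sz t * h0 t = \sum_t sz t * g t + r ->
  (forall t, g t <= h0 t \/ s <= h0 t) ->
  exists h : T -> nat,
    [/\ \sum_t sz t * h t = \sum_t sz t * h0 t,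
        forall t, h t <= h0 t \/ s <= h0 t
      & \sum_t sz t * (h t - g t) <= #|T| * (M * M) + r].
Proof.
move=> szM volE dom.
suff [h [hvol hdom hbd]] : exists h : T -> nat,
    [/\ \sum_t sz t * h t = \sum_t sz t * h0 t,
        forall t, h t <= h0 t \/ s <= h0 t
      & (forall t, g t - h t <= M) \/ (forall t, h t - g t <= M)].
  exists h; split => //.
  have bd u : (forall t, u t <= M) -> \sum_t sz t * u t <= #|T| * (M * M).
    move=> uM; rewrite -sum_nat_const; apply: leq_sum => t _.
    by apply: leq_mul => //; case/andP: (szM t).
  (* The weighted sums of [h] and [g] differ by [r], so the total excess of [h] over [g] is the
     total deficit plus [r]; bounding either one suffices. *)
  case: hbd => [/bd pbd|/bd]; last lia.
  have : \sum_t sz t * (h t - g t) + \sum_t sz t * g t =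
         \sum_t sz t * h t + \sum_t sz t * (g t - h t).
    rewrite -!big_split; apply: eq_bigr => t _ /=.
    by rewrite -!mulnDr; congr (_ * _); lia.
  by lia.
have : exists h : T -> nat, \sum_t sz t * h t = \sum_t sz t * h0 t /\
        forall t, h t <= h0 t \/ s <= h0 t.
  by exists h0; split => // t; left.
case=> h [hvol hdom]; have [k] := ubnP (\sum_t (g t - h t)).
elim: k h hvol hdom => // k IH h hvol hdom hk.
have [p_small|] := boolP [forall t, g t - h t <= M].
  by exists h; split => //; left => t; apply: (forallP p_small).
rewrite negb_forall => /existsP[i]; rewrite -ltnNge => pi.
have [q_small|] := boolP [forall t, h t - g t <= M].
  by exists h; split => //; right => t; apply: (forallP q_small).
rewrite negb_forall => /existsP[j]; rewrite -ltnNge => qj.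
have ij : i == j = false by apply/eqP => ij; move: pi qj; rewrite ij; lia.
have ji : j == i = false by rewrite eq_sym.
have := szM i; have := szM j => szj szi.
(* The entry [i] is short by more than [M] and [j] is in excess by more than [M]. Weights are at
   most [M], so the trade overshoots at neither entry and the total deficit drops by [sz j]. *)
pose h' t := if t == i then h t + sz j else if t == j then h t - sz i else h t.
have h'E t : h' t + (t == j) * sz i = h t + (t == i) * sz j.
  rewrite /h'; have [->|ti] := eqVneq t i; first by rewrite ij; lia.
  by have [->|tj] := eqVneq t j; lia.
apply: (IH h').
- have : \sum_t sz t * (h' t + (t == j) * sz i) =
         \sum_t sz t * (h t + (t == i) * sz j).
    by apply: eq_bigr => t _; rewrite h'E.
  under eq_bigr do rewrite mulnDr.
  under [X in _ = X]eq_bigr do rewrite mulnDr.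
  rewrite !big_split /= !sum_mul_indicator hvol; lia.
- move=> t; rewrite /h'; have [->|ti] := eqVneq t i.
    by have := dom i; lia.
  by have := hdom t; have [->|tj] := eqVneq t j; lia.
- suff : \sum_t (g t - h' t) + sz j <= \sum_t (g t - h t) by lia.
  rewrite -[sz j](mul1n) -(sum_mul_indicator (fun => 1) i (sz j)) -big_split /=.
  apply: leq_sum => t _; have := h'E t.
  have [->|ti] := eqVneq t i; first by rewrite ij; lia.
  by have [->|tj] := eqVneq t j; lia.
Qed.

(** The shift by one makes the index type [bool * 'I_M] enumerate the shapes of sizes 1 to [M]. *)
Definition shape_of M (t : bool * 'I_M) : bool * nat := (t.1, t.2.+1).

Lemma shape_of_inj M : injective (@shape_of M).
Proof. by move=> [b i] [b' j] [-> /val_inj ->]. Qed.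

Lemma size_vertices_shapes (V : Type) M (l : seq (bool * seq V)) :
  all (fun c => 0 < size c.2) l -> all (fun c => size c.2 <= M) l ->
  size (vertices l) =
  \sum_(t : bool * 'I_M)
    t.2.+1 * count_mem (shape_of t) (map (@comp_shape _) l).
Proof.
elim: l => [|c l IH] /=; first by move=> _ _; rewrite big1// => t; rewrite muln0.
move=> /andP[c0 l0] /andP[cM lM]; rewrite vertices_cons size_cat IH//.
under [RHS]eq_bigr do rewrite mulnDr.
rewrite [RHS]big_split /=; congr (_ + _).
have cM' : (size c.2).-1 < M by lia.
pose t0 : bool * 'I_M := (c.1, Ordinal cM').
have t0E : comp_shape c = shape_of t0 by rewrite /comp_shape /shape_of /= prednK.
rewrite t0E; under eq_bigr do rewrite (inj_eq (@shape_of_inj M)) eq_sym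
  -(muln1 (_ == _)).
by rewrite (sum_mul_indicator (fun t : bool * 'I_M => t.2.+1)) /= prednK ?muln1.
Qed.

Lemma seq_of_counts (T : finType) (u : T -> nat) :
  exists e : seq T, forall t, count_mem t e = u t.
Proof.
exists (flatten [seq nseq (u t) t | t <- enum T]) => t.
rewrite count_flatten -map_comp sumnE big_map big_enum /=.
rewrite (bigD1 t)//= big1 ?addn0; first by rewrite count_nseq /= eqxx mul1n.
by move=> i ti; rewrite count_nseq /= (negPf ti).
Qed.

Lemma sumn_counts (T : finType) (sz : T -> nat) (e : seq T) :
  sumn (map sz e) = \sum_t sz t * count_mem t e.
Proof.
elim: e => [|x e IH] /=; first by rewrite big1// => t; rewrite muln0.
rewrite IH; under [RHS]eq_bigr do rewrite mulnDr eq_sym -(muln1 (_ == _)).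
by rewrite [RHS]big_split /= sum_mul_indicator muln1.
Qed.

Lemma fill_shapes (V : Type) (e : seq (bool * nat)) (rs : seq V) :
  size rs = sumn (map snd e) ->
  exists2 fl : seq (bool * seq V),
    vertices fl = rs & map (@comp_shape _) fl = e.
Proof.
elim: e rs => [|[b m] e IH] rs /=.
  by move=> /size0nil ->; exists [::].
move=> rsE; have [|fl flv fls] := IH (drop m rs).
  by rewrite size_drop rsE addKn.
exists ((b, take m rs) :: fl).
  by rewrite vertices_cons flv cat_take_drop.
by rewrite /= fls /comp_shape /= size_takel// rsE leq_addr.
Qed.

Lemma count_mem_le (V : finType) (A : {set V}) (p : seq V) :
  uniq p -> count (mem A) p <= #|A|.
Proof.
move=> up; rewrite -size_filter -(card_uniqP (filter_uniq _ up)).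
by apply/subset_leq_card/subsetP => x; rewrite mem_filter => /andP[].
Qed.

Lemma count_has_vertices (V : Type) (a : pred V) (l : seq (bool * seq V)) :
  count (fun c => has a c.2) l <= count a (vertices l).
Proof.
elim: l => //= c l IH; rewrite vertices_cons count_cat leq_add//.
by rewrite has_count; case: (count _ _).
Qed.

(** Cut [p] into blocks of length [M]: each full block contains its own hit, and the remainder is
    shorter than [M]. *)
Lemma size_hit_every (V : Type) (a : pred V) M (p : seq V) : 0 < M ->
  (forall p1 q p2, p = p1 ++ q ++ p2 -> M <= size q -> has a q) ->
  size p < M * (count a p).+1.
Proof.
move=> M0; have [k] := ubnP (size p); elim: k p => // k IH p pk hit.
have [pM|pM] := ltnP (size p) M; first by nia.
have sd : size (drop M p) = size p - M by rewrite size_drop.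
have /IH : size (drop M p) < k by lia.
have cE : count a p = count a (take M p) + count a (drop M p).
  by rewrite -count_cat cat_take_drop.
have : has a (take M p).
  by apply: (hit [::] _ (drop M p)); rewrite ?cat_take_drop// size_takel.
rewrite has_count => c0 lt.
have {}/lt : forall p1 q p2, drop M p = p1 ++ q ++ p2 -> M <= size q -> has a q.
  move=> p1 q p2 E; apply: (hit (take M p ++ p1) _ p2).
  by rewrite -catA -E cat_take_drop.
rewrite sd cE; nia.
Qed.

(** A touched component has a count [c >= 1], hence fewer than [M * (c + 1) <= 2 * M * c]
    vertices. *)
Lemma size_touched (V : eqType) (a : pred V) M (l : seq (bool * seq V)) :
  {in l, forall c, size c.2 < M * (count a c.2).+1} ->
  size (vertices [seq c <- l | has a c.2]) <= 2 * M * count a (vertices l).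
Proof.
elim: l => //= c l IH hl; rewrite vertices_cons count_cat.
have {}/IH IH : {in l, forall c, size c.2 < M * (count a c.2).+1}.
  by move=> c' c'l; apply: hl; rewrite inE c'l orbT.
have := hl c (mem_head _ _); rewrite has_count; case: posnP => [_|c0] lt /=.
  by nia.
by rewrite vertices_cons size_cat; nia.
Qed.

(* Counting the j <= u with j or j - 1 in A shrinks every gap of A to one
   missing position. *)
Lemma compress_positions (A : seq nat) : uniq A ->
  exists g : nat -> nat, {in A, forall u, 0 < g u <= 2 * size A} /\
    {in A &, forall u v, u < v ->
       if v == u.+1 then g v = (g u).+1 else (g u).+1 < g v}.
Proof.
move=> uA; pose a j := (j \in A) || (j \in map S A).
exists (fun u => count a (iota 0 u.+1)); split=> [u uA'|u v uA' vA' uv].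
  apply/andP; split.
    by rewrite -has_count; apply/hasP; exists u; rewrite ?mem_iota /a ?uA'//; lia.
  rewrite -size_filter mul2n -addnn -{2}(size_map S A) -size_cat.
  apply: uniq_leq_size; first by rewrite filter_uniq ?iota_uniq.
  by move=> j; rewrite mem_filter mem_cat => /andP[].
have -> : iota 0 v.+1 = iota 0 u.+1 ++ iota u.+1 (v - u).
  by rewrite -iotaD; congr iota; lia.
rewrite count_cat; have [->|vu] := eqVneq v u.+1.
  by rewrite subSnn /= /a (map_f S uA') orbT addn0 addn1.
have -> : iota u.+1 (v - u) = iota u.+1 1 ++ iota u.+2 (v - u.+2) ++ iota v 1.
  have -> : v - u = 1 + ((v - u.+2) + 1) by lia.
  rewrite !iotaD addn1; congr (_ ++ (_ ++ iota _ 1)); lia.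
by rewrite !count_cat /= /a (map_f S uA') vA' orbT /=; lia.
Qed.

(** * Long cycles and segments *)

(** Only inner vertices of [q] are constrained, and their neighbourhoods are fixed in all of [X];
    the two ends may have any other neighbours. *)
Definition segment (W : finType) (X : graph W) (q : seq W) : Prop :=
  uniq q /\ forall l u x w r, q = l ++ [:: u, x, w & r] ->
    forall y, X x y = (y == u) || (y == w).

Lemma layout_segment (W : finType) (X : graph W) l c p1 q p2 :
  partial_layout X l -> c \in l -> c.2 = p1 ++ q ++ p2 -> segment X q.
Proof.
move=> Xl cl cE; have [_ un _] := Xl.
have uc : uniq c.2.
  move: un; rewrite (perm_uniq (perm_vertices (perm_to_rem cl))).
  by rewrite vertices_cons cat_uniq => /and3P[].
split; first by move: uc; rewrite cE !cat_uniq => /and3P[_ _ /and3P[]].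
move=> l1 u x w r qE y.
have cE' : c.2 = (p1 ++ l1) ++ [:: u, x, w & (r ++ p2)].
  by rewrite cE qE -!catA.
rewrite (partial_layout_comp _ Xl cl); last first.
  by rewrite cE' mem_cat !inE eqxx !orbT.
by rewrite (surjective_pairing c) cE' comp_adj_inner -?cE'.
Qed.

Lemma segment_nth (W : finType) (X : graph W) q w0 i y :
  segment X q -> 0 < i -> i.+1 < size q ->
  X (nth w0 q i) y = (y == nth w0 q i.-1) || (y == nth w0 q i.+1).
Proof.
move=> [_ seg] i0 iq.
apply: (seg (take i.-1 q) _ _ _ (drop i.+2 q)).
rewrite -[LHS](cat_take_drop i.-1) (drop_nth w0) ?prednK//; last lia.
by rewrite (drop_nth w0); last lia; rewrite (drop_nth w0).
Qed.

(** For positions below [m], this is [i - i0] modulo [m]: the cycle renumbered from [i0]. *)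
Definition rotate_pos (m i0 i : nat) : nat :=
  if i0 <= i then i - i0 else i + m - i0.

Lemma rotate_pos_lt m i0 i : i0 < m -> i < m -> rotate_pos m i0 i < m.
Proof. by rewrite /rotate_pos; case: (leqP i0 i); lia. Qed.

Lemma rotate_pos_inj m i0 i j : i0 < m -> i < m -> j < m ->
  rotate_pos m i0 i = rotate_pos m i0 j -> i = j.
Proof. by rewrite /rotate_pos; case: (leqP i0 i); case: (leqP i0 j); lia. Qed.

Lemma rotate_pos_onto m i0 k : i0 < m -> k < m ->
  exists2 i, i < m & rotate_pos m i0 i = k.
Proof.
move=> im km; have [h|h] := ltnP (k + i0) m.
  by exists (k + i0) => //; rewrite /rotate_pos; case: leqP; lia.
exists (k + i0 - m); first lia.
by rewrite /rotate_pos; case: leqP; lia.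
Qed.

Lemma rotate_pos_adj m i0 i j : i0 < m -> i < m -> j < m -> 1 < m ->
  index_adj true m (rotate_pos m i0 i) (rotate_pos m i0 j) =
  index_adj true m i j.
Proof. by rewrite /rotate_pos /index_adj; case: (leqP i0 i); case: (leqP i0 j); lia. Qed.

(* A vertex of the cycle outside U cuts it open; the part of U on the opened
   cycle then fits into the inside of the segment q. *)
Lemma cycle_local_map (V W : finType) (H : graph V) (X : graph W) (w0 : W)
    (z : seq V) (q : seq W) (U : {set V}) (psi : V -> W) :
  uniq z -> (forall x y, x \in z -> H x y = comp_adj (true, z) x y) ->
  #|U| < size z -> 2 < size z ->
  segment X q -> 2 * #|U| + 2 <= size q ->
  local_map H X (U :\: [set x in z]) psi ->
  {in U, forall x, x \notin z -> psi x \notin q} ->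
  exists phi, local_map H X U phi /\
    {in U, forall x, (x \notin z) && (phi x == psi x) || (phi x \in q)}.
Proof.
move=> uz Hz Uz z3 seg qU [pinj padj pfull] pq.
have [uq _] := seg.
set m := size z in Uz z3.
have [v0 v0z v0U] : exists2 v, v \in z & v \notin U.
  apply/hasP; rewrite -[has _ _]negbK -all_predC; apply/negP => /allP h.
  move: Uz; rewrite ltnNge => /negP; apply; rewrite /m -(card_uniqP uz).
  apply/subset_leq_card/subsetP => x /h /=; by rewrite negbK.
set i0 := index v0 z; have i0m : i0 < m by rewrite index_mem.
pose pos x := rotate_pos m i0 (index x z).
have im x : x \in z -> index x z < m by rewrite index_mem.
have posm x : x \in z -> pos x < m by move=> /im; apply: rotate_pos_lt.
have pos_inj : {in z &, injective pos}.
  move=> x y xz yz /(rotate_pos_inj i0m (im _ xz) (im _ yz)) h.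
  by rewrite -(nth_index x xz) h nth_index.
have pos0 : pos v0 = 0 by rewrite /pos /rotate_pos leqnn subnn.
have onto k : k < m -> exists2 x, x \in z & pos x = k.
  move=> km; have [i ilt iE] := rotate_pos_onto i0m km.
  exists (nth v0 z i); first exact: mem_nth.
  by rewrite /pos index_uniq.
have HE x y : x \in z -> y \in z ->
    H x y = (pos x != pos y) && index_adj true m (pos x) (pos y).
  move=> xz yz; rewrite Hz// /comp_adj /= xz yz /= rotate_pos_adj ?im//; last lia.
  by congr (~~ _ && _); apply/eqP/eqP => [->//|]; apply: pos_inj.
pose A := [seq pos x | x in [set x in U | x \in z]].
have inA x : x \in U -> x \in z -> pos x \in A.
  by move=> xU xz; apply/imageP; exists x; rewrite ?inE ?xU.
have uA : uniq A.
  rewrite map_inj_in_uniq ?enum_uniq// => x y.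
  by rewrite !mem_enum !inE => /andP[_ xz] /andP[_ yz]; apply: pos_inj.
have sA : size A <= #|U|.
  rewrite size_map -cardE; apply/subset_leq_card/subsetP => x.
  by rewrite inE => /andP[].
have [g [g_bd g_lt]] := compress_positions uA.
(* Values of [g] lie between 1 and [2 * #|U|], and [q] has at least two more vertices, so every
   image is an inner vertex of [q]. *)
have gq u : u \in A ->
    [/\ 0 < g u, (g u).-1 < size q, g u < size q & (g u).+1 < size q].
  by move=> /g_bd /andP[? ?]; split; lia.
have g_inj : {in A &, injective g}.
  move=> u v uA' vA' guv; have [uv|vu|//] := ltngtP u v.
    by have := g_lt _ _ uA' vA' uv; case: ifP; lia.
  by have := g_lt _ _ vA' uA' vu; case: ifP; lia.
have g_succ u v : u \in A -> v \in A -> (g v == (g u).+1) = (v == u.+1).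
  move=> uA' vA'; have [uv|vu|->] := ltngtP u v; last lia.
    by have := g_lt _ _ uA' vA' uv; case: ifP; lia.
  by have := g_lt _ _ vA' uA' vu; case: ifP; lia.
pose f x := if x \in z then nth w0 q (g (pos x)) else psi x.
have fz x : x \in z -> f x = nth w0 q (g (pos x)) by rewrite /f => ->.
have fnz x : x \notin z -> f x = psi x by rewrite /f => /negPf ->.
have fq x : x \in U -> x \in z -> f x \in q.
  move=> xU xz; rewrite fz// mem_nth//.
  by have [] := gq _ (inA _ xU xz).
have pos_gt0 x : x \in U -> x \in z -> 0 < pos x.
  move=> xU xz; rewrite lt0n; apply: contraNneq v0U => h.
  by rewrite -(pos_inj _ _ xz v0z) ?pos0.
have inD x : x \in U -> x \notin z -> x \in U :\: [set x in z].
  by move=> xU xz; rewrite !inE xU xz.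
have Hmix x y : x \in z -> y \notin z -> H x y = false.
  by move=> xz yz; apply/negbTE; rewrite Hz//; apply: contra yz => /comp_adj_mem/andP[].
have Xmix x y : x \in U -> x \in z -> y \in U -> y \notin z ->
    X (f x) (f y) = false.
  move=> xU xz yU yz; have [g1 g2 g3 g4] := gq _ (inA _ xU xz).
  rewrite fz// (segment_nth _ _ seg)// fnz//; have := pq _ yU yz => ynq.
  apply/negbTE; rewrite negb_or; apply/andP; split; apply: contraNneq ynq => ->;
    exact: mem_nth.
exists f; split; last first.
  move=> x xU; have [xz|xz] := boolP (x \in z); first by rewrite (fq x)// orbT.
  by rewrite fnz// eqxx.
split.
- move=> x y xU yU; have [xz|xz] := boolP (x \in z); have [yz|yz] := boolP (y \in z).
  + have [g1 g2 g3 g4] := gq _ (inA _ xU xz).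
    have [g5 g6 g7 g8] := gq _ (inA _ yU yz).
    rewrite !fz// => /eqP; rewrite nth_uniq//.
    by move=> /eqP /(g_inj _ _ (inA _ xU xz) (inA _ yU yz)); apply: pos_inj.
  + by move=> h; have := pq y yU yz; rewrite -(fnz y)// -h fq.
  + by move=> h; have := pq x xU xz; rewrite -(fnz x)// h fq.
  + by rewrite !fnz//; apply: pinj; apply: inD.
- move=> x y xU yU; have [xz|xz] := boolP (x \in z); have [yz|yz] := boolP (y \in z).
  + have xA := inA _ xU xz; have yA := inA _ yU yz.
    have [g1 g2 g3 g4] := gq _ xA; have [g5 g6 g7 g8] := gq _ yA.
    rewrite !fz// (segment_nth _ _ seg)// !nth_uniq//.
    rewrite HE//; have := g_succ _ _ xA yA; have := g_succ _ _ yA xA.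
    have := pos_gt0 _ xU xz; have := pos_gt0 _ yU yz.
    rewrite /index_adj; lia.
  + by rewrite Xmix// Hmix.
  + by rewrite adj_sym Xmix// adj_sym Hmix.
  + by rewrite !fnz// padj// inD.
- move=> x xU; have [xz|xz] := boolP (x \in z); last first.
    move=> full w; rewrite fnz// => Xw.
    have [||y] := pfull x _ _ w Xw; first exact: inD.
      move=> y Hxy; rewrite !inE full// andbT.
      by apply: contraL Hxy => yz; rewrite adj_sym Hmix.
    by rewrite !inE => /andP[yz yU] ->; exists y; rewrite ?fnz.
  move=> full w.
  have xA := inA _ xU xz; have [g1 g2 g3 g4] := gq _ xA; have x0 := pos_gt0 _ xU xz.
  have xm := posm _ xz.
  have nbr k : k < m -> pos x != k -> index_adj true m (pos x) k ->
      exists2 y, y \in U & (y \in z) && (pos y == k).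
    move=> km xk adjk; have [y yz yk] := onto k km.
    exists y; last by rewrite yz yk eqxx.
    by apply: full; rewrite HE// yk xk.
  (* A full vertex next to position 0 would force [v0] into [U]. Hence the two neighbours of [x] sit
     at [pos x - 1] and [pos x + 1], without wrap-around. *)
  have not0 : ~~ index_adj true m (pos x) 0.
    apply/negP => /nbr[||y yU /andP[yz /eqP y0]]; try lia.
    by have := pos_gt0 _ yU yz; rewrite y0.
  rewrite fz// (segment_nth _ _ seg)// => /orP[] /eqP ->.
    have [|||y yU /andP[yz /eqP yE]] := nbr (pos x).-1.
    - lia.
    - lia.
    - by rewrite /index_adj; lia.
    exists y => //; rewrite fz//; congr nth.
    have := g_succ _ _ (inA _ yU yz) xA; lia.
  have [|||y yU /andP[yz /eqP yE]] := nbr (pos x).+1.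
  - by move: not0; rewrite /index_adj; lia.
  - lia.
  - by rewrite /index_adj; lia.
  exists y => //; rewrite fz//; congr nth.
  have := g_succ _ _ xA (inA _ yU yz); lia.
Qed.

Lemma size_vertices_ge (V : Type) (l : seq (bool * seq V)) :
  all (fun c => 0 < size c.2) l -> size l <= size (vertices l).
Proof.
elim: l => //= c l IH /andP[c0 /IH h].
by rewrite vertices_cons size_cat -add1n leq_add.
Qed.

Lemma size_uniq_full (V : finType) (p : seq V) :
  uniq p -> (forall x, x \in p) -> size p = #|V|.
Proof. by move=> up full; rewrite -(card_uniqP up); apply: eq_card => x; rewrite full. Qed.

Lemma inner_split (V : eqType) (p : seq V) v0 x :
  x \in p -> x != head v0 p -> x != last v0 p ->
  exists l u w r, p = l ++ [:: u, x, w & r].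
Proof.
case/splitPr => p1 [|w r]; first by rewrite last_cat /= eqxx.
case: (lastP p1) => [|l u]; first by rewrite /= eqxx.
by move=> _ _; exists l, u, w, r; rewrite cat_rcons.
Qed.

(** A set of at most [s] vertices meets at most [s] components, so counts matter only up to [s]. *)
Lemma touched_local_map (V W : finType) (H : graph V) (X : graph W) (w0 : W)
    l l' s (U : {set V}) :
  partial_layout H l -> partial_layout X l' ->
  (forall t, minn s (count_mem t (map (@comp_shape _) l)) <=
             count_mem t (map (@comp_shape _) l')) ->
  #|U| <= s ->
  exists phi, local_map H X [set x in U | x \in vertices l] phi /\
    {in U, forall x, x \in vertices l -> phi x \in vertices l'}.
Proof.
move=> Hl Xl' cnt Us; pose tc := [seq c <- l | has (mem U) c.2].
have tcs : size tc <= s.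
  rewrite size_filter; apply: leq_trans (count_has_vertices _ _) _.
  by apply: leq_trans Us; apply: count_mem_le; case: Hl.
have tcl : subseq tc l by apply: filter_subseq.
have [||phi [loc im]] := @match_layouts _ _ H X tc l' w0 _ Xl'.
- exact: partial_layout_subseq tcl Hl.
- move=> t; apply: leq_trans (cnt t); rewrite leq_min; apply/andP; split.
    by apply: leq_trans tcs; rewrite -(size_map (@comp_shape _)) count_size.
  by apply: leq_count_subseq; apply: map_subseq.
have inT x : x \in U -> x \in vertices l -> x \in vertices tc.
  move=> xU /verticesP[c cl xc]; apply/verticesP; exists c => //.
  by rewrite mem_filter cl andbT; apply/hasP; exists x.
exists phi; split; last by move=> x xU xl; apply: im; apply: inT.
apply: local_map_sub loc => //; apply/subsetP => x.
by rewrite !inE => /andP[xU xl]; apply: inT.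
Qed.

(** * A member of the property near G *)

Section NearestMember.
Variables (d : nat) (P : graph_class) (hP : is_property d P).
Variables (n s : nat) (Fs : marked_set).
Hypotheses (d2 : d <= 2) (ds : d.+2 <= s).
Hypothesis Fsize : forall F, Fs F -> #|mg_vertex F| <= s.
Hypothesis Ploc : forall (W : finType) (X : graph W), #|W| = n ->
  (P X <-> free_class d Fs X).

(** [M] is the segment length that [cycle_local_map] asks for when [#|U| <= s]. [m] bounds a sample
    with at most [s] components of each of the [2 * M] shapes, each on at most [M] vertices. *)
Let M := 2 * s + 2.
Let m := 2 * M * (M * s).

Variables (V : finType) (G : graph V) (B : {set V}).
Hypotheses (Vn : #|V| = n) (dG : bounded_degree d G).
Hypothesis (cov : covers (unrealised P n m) G B).
Variables (v0 : V) (v0B : v0 \in B).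

Let n0 : 0 < n.
Proof. by rewrite -Vn; apply/card_gt0P; exists v0. Qed.

Let dG2 : bounded_degree 2 G.
Proof. by move=> x; apply: leq_trans (dG x) d2. Qed.

Let B0 : 0 < #|B|.
Proof. by apply/card_gt0P; exists v0. Qed.

Definition realised (H : graph V) (U : {set V}) : Prop :=
  exists (W : finType) (X : graph W) (phi : V -> W),
    [/\ #|W| = n, P X & local_map H X U phi].

Lemma realised_property (H : graph V) :
  (forall U : {set V}, #|U| <= s -> realised H U) -> P H.
Proof. exact: (local_maps_property hP Vn ds Fsize Ploc). Qed.

(** * Merging the components of [a] into one cycle while keeping [k] *)

Section MergeIntoCycle.
Variables (k a : seq (bool * seq V)).
Hypothesis Gka : partial_layout G (k ++ a).
Hypothesis ka_full : forall x, x \in vertices (k ++ a).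
Hypothesis a_large : M <= size (vertices a).

Definition merged : graph V := layout_graph (k ++ [:: (true, vertices a)]).

Let ua : uniq (vertices a).
Proof. by case: Gka => _ + _; rewrite vertices_cat cat_uniq => /and3P[]. Qed.

Let merged_vertices :
  vertices (k ++ [:: (true, vertices a)]) = vertices (k ++ a).
Proof. by rewrite !vertices_cat [X in _ ++ X]cats0. Qed.

Lemma merged_layout : partial_layout merged (k ++ [:: (true, vertices a)]).
Proof.
apply: layout_graph_partial_layout; last by rewrite merged_vertices; case: Gka.
case: Gka => + _ _; rewrite !all_cat => /andP[-> _] /=.
by rewrite andbT; apply: leq_trans a_large; rewrite /M addn2.
Qed.

Lemma merged_kept x y : x \in vertices k -> merged x y = G x y.
Proof.
move=> xk; have [_ _ ->] := partial_layout_catl Gka => //.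
by have [_ _ ->] := partial_layout_catl merged_layout.
Qed.

Lemma merged_kept_local_map (U : {set V}) (W : finType) (X : graph W) phi :
  local_map G X [set x in U | x \in vertices k] phi ->
  local_map merged X (U :\: [set x in vertices a]) phi.
Proof.
have sub x : x \notin vertices a -> x \in vertices k.
  by have := ka_full x; rewrite vertices_cat mem_cat => /orP[->|->].
apply: local_map_sub.
  by apply/subsetP => x; rewrite !inE => /andP[xa ->]; apply: sub.
by move=> x; rewrite !inE => /andP[/sub xk _] y; rewrite merged_kept.
Qed.

Lemma merged_local_map (W : finType) (X : graph W) (w0 : W) q (U : {set V})
    psi :
  #|U| <= s -> segment X q -> M <= size q ->
  local_map G X [set x in U | x \in vertices k] psi ->
  {in U, forall x, x \in vertices k -> psi x \notin q} ->
  exists phi, local_map merged X U phi /\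
    {in U, forall x, (x \in vertices k) && (phi x == psi x) || (phi x \in q)}.
Proof.
move=> Us seg qM /merged_kept_local_map loc pq.
have sub x : x \notin vertices a -> x \in vertices k.
  by have := ka_full x; rewrite vertices_cat mem_cat => /orP[->|->].
have [|||||phi [locphi im]] :=
  @cycle_local_map _ _ merged X w0 _ q U psi ua _ _ _ seg _ loc.
- move=> x y xa; apply: (partial_layout_comp _ merged_layout) => //.
  by rewrite mem_cat mem_head orbT.
- by apply: leq_trans a_large; rewrite /M; lia.
- by apply: leq_trans a_large; rewrite /M; lia.
- by apply: leq_trans qM; rewrite /M; lia.
- by move=> x xU /sub; apply: pq.
exists phi; split => // x xU.
by case/orP: (im x xU) => [/andP[/sub -> ->]|->]; rewrite ?orbT.
Qed.

(** The components of [a] are strung together in order, so only their end vertices, at most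
    [2 * size a] in number, can change neighbourhoods; each costs at most [d <= 2] edits. *)
Lemma merged_close :
  (forall U : {set V}, #|U| <= s -> realised merged U) ->
  P merged /\ edit_distance G merged <= 4 * size a.
Proof.
move=> /realised_property Pm; split => //.
pose ends := flatten [seq [:: head v0 c.2; last v0 c.2] | c <- a].
have endsE : #|[set x in ends]| <= 2 * size a.
  rewrite cardsE; apply: leq_trans (card_size _) _.
  rewrite /ends; elim: (a) => //= c l IH; rewrite mulnS.
  by rewrite -addn2 addnC leq_add2l.
have inner x y : x \notin [set x in ends] -> G x y = merged x y.
  rewrite inE => xe; have := ka_full x; rewrite vertices_cat mem_cat.
  case/orP => [xk|/verticesP[c ca xc]]; first by rewrite merged_kept.
  have [||l [u [w [r cE]]]] := @inner_split _ c.2 v0 x xc.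
  - by apply: contraNneq xe => ->; apply/flatten_mapP; exists c; rewrite ?inE ?eqxx.
  - by apply: contraNneq xe => ->; apply/flatten_mapP; exists c; rewrite ?inE ?eqxx ?orbT.
  have uc : uniq c.2.
    move: ua; rewrite (perm_uniq (perm_vertices (perm_to_rem ca))).
    by rewrite vertices_cons cat_uniq => /and3P[].
  have cka : c \in k ++ a by rewrite mem_cat ca orbT.
  rewrite (partial_layout_comp _ Gka cka)//.
  rewrite (surjective_pairing c) cE comp_adj_inner -?cE//.
  have [a1 [a2 aE]] : exists a1 a2, a = a1 ++ c :: a2.
    by case/splitPr: ca => a1 a2; exists a1, a2.
  have zE : vertices a = (vertices a1 ++ l) ++ [:: u, x, w & r ++ vertices a2].
    by rewrite aE vertices_cat vertices_cons cE -!catA.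
  rewrite (@partial_layout_comp _ _ _ (true, vertices a) _ _ merged_layout).
  - by rewrite zE comp_adj_inner -?zE.
  - by rewrite mem_cat mem_head orbT.
  - by rewrite /= zE mem_cat !inE eqxx !orbT.
have := edit_distance_le dG (hP.2 _ _ Pm) inner; nia.
Qed.

End MergeIntoCycle.

Let touched (c : bool * seq V) := has (mem B) c.2.

Let touched_count l : partial_layout G l -> count touched l <= #|B|.
Proof.
by move=> [_ ul _]; apply: leq_trans (count_has_vertices _ _) (count_mem_le _ ul).
Qed.

Let untouchedN (l : seq (bool * seq V)) x :
  x \in vertices (filter (predC touched) l) -> x \notin B.
Proof.
case/verticesP => c; rewrite mem_filter => /andP[/= /hasPn h _]; exact: h.
Qed.

(** Merge the component of [q] with the components meeting [B]. A small set of the merged graph is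
    first mapped back into [G] off [B], and from there into a member by covering. *)
Lemma long_segment_close l c p1 q p2 :
  partial_layout G l -> (forall x, x \in vertices l) ->
  c \in l -> c.2 = p1 ++ q ++ p2 -> M <= size q -> ~~ has (mem B) q ->
  exists2 H, P H & edit_distance G H <= 8 * #|B|.
Proof.
move=> Gl lfull cl cE qM qB.
pose k := filter (predC touched) (rem c l).
pose a := c :: filter touched (rem c l).
have lE : perm_eq l (k ++ a).
  apply: perm_trans (perm_to_rem cl) _.
  by rewrite perm_sym perm_catC /= perm_cons perm_filterC.
have Gka := perm_partial_layout lE Gl.
have kafull x : x \in vertices (k ++ a) by rewrite -(perm_mem (perm_vertices lE)).
have qc x : x \in q -> x \in vertices a.
  by move=> xq; rewrite vertices_cons mem_cat cE !mem_cat xq !orbT.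
have alarge : M <= size (vertices a).
  rewrite vertices_cons size_cat cE !size_cat; lia.
have sa : size a <= #|B|.+1.
  rewrite /= size_filter ltnS; apply: touched_count.
  by apply: partial_layout_subseq Gl; apply: rem_subseq.
have [|Pm ed] := merged_close Gka kafull alarge; last first.
  exists (merged k a) => //; apply: leq_trans ed _.
  (* The merged list has at most [#|B| + 1] components; [B] is nonempty, so the extra one is
     absorbed by doubling. *)
  apply: (@leq_trans (4 * #|B|.+1)); first by rewrite leq_mul2l.
  by have := B0; lia.
move=> U Us.
have seg := layout_segment Gl cl cE.
(* The target is [G] itself: kept components stay in place through [id], and the cycle is placed
   inside [q]. *)
have [||phi [loc im]] :=
  @merged_local_map k a Gka kafull alarge V G v0 q U id Us seg qM.
- split=> //; first by move=> x xU full w /full wU; exists w.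
- move=> x _ xk; apply/negP => /qc xa.
  have [_ + _] := Gka; rewrite vertices_cat cat_uniq => /and3P[_ /hasPn/(_ x xa)].
  by rewrite /= xk.
have [| |W [X [psi [Wn PX locpsi]]]] :=
  covers_local_map (U := phi @: U) Vn n0 cov.
- apply: leq_trans (leq_imset_card _ _) _; apply: leq_trans Us _.
  by rewrite /m /M; nia.
- rewrite disjoint_subset; apply/subsetP => _ /imsetP[x xU ->]; rewrite inE.
  case/orP: (im x xU) => [/andP[xk /eqP ->]|xq]; first exact: untouchedN xk.
  by apply: (hasPn qB).
exists W, X, (psi \o phi); split => //; exact: local_map_comp loc locpsi.
Qed.

(** * The case in which every long segment meets [B] *)

Section ShortSegments.
Variable l : seq (bool * seq V).
Hypotheses (Gl : partial_layout G l) (lfull : forall x, x \in vertices l).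
Hypothesis short : {in l, forall c p1 q p2,
  c.2 = p1 ++ q ++ p2 -> M <= size q -> has (mem B) q}.

Let k := filter (predC touched) l.
Let a := filter touched l.

Let lE : perm_eq l (k ++ a).
Proof. by rewrite perm_sym perm_catC perm_filterC. Qed.

Let Gka : partial_layout G (k ++ a) := perm_partial_layout lE Gl.

Let Gk : partial_layout G k := partial_layout_catl Gka.

Let M0 : 0 < M. Proof. by rewrite /M addn2. Qed.

Let size_comp c : c \in l -> size c.2 < M * (count (mem B) c.2).+1.
Proof. by move=> cl; apply: size_hit_every M0 _; apply: short. Qed.

Lemma size_untouched : all (fun c => size c.2 <= M) k.
Proof.
apply/allP => c; rewrite mem_filter => /andP[/= nt /size_comp].
by move: nt; rewrite /touched has_count -eqn0Ngt => /eqP ->; rewrite muln1 => /ltnW.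
Qed.

Lemma size_vertices_touched : size (vertices a) <= 2 * M * #|B|.
Proof.
apply: leq_trans (size_touched size_comp) _.
by rewrite leq_mul2l count_mem_le ?orbT//; case: Gl.
Qed.

(** Take at most [s] untouched components of each shape. Together they have at most [m] vertices and
    avoid [B], so covering places them as whole components in a single member. *)
Lemma member_with_untouched :
  exists (W : finType) (X : graph W) (l0 : seq (bool * seq W)),
  [/\ #|W| = n, P X, partial_layout X l0, forall w, w \in vertices l0
    & forall t, minn s (count_mem t (map (@comp_shape _) k)) <=
               count_mem t (map (@comp_shape _) l0)].
Proof.
have [S Sk Scnt] := capped_subseq (@comp_shape V) (fun => s) k.
have GS := partial_layout_subseq Sk Gk.
have Sm : size (vertices S) <= m.
  rewrite (@size_vertices_shapes _ M).
  - apply: (@leq_trans (\sum_(t : bool * 'I_M) M * s)).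
      by apply: leq_sum => t _; rewrite Scnt leq_mul// geq_minl.
    by rewrite sum_nat_const card_prod card_bool card_ord.
  - by case: GS.
  - by apply/allP => c /(mem_subseq Sk); apply: (allP size_untouched).
have [||W [X [phi [Wn PX loc]]]] :=
  covers_local_map (U := [set x in vertices S]) Vn n0 cov.
- by rewrite cardsE; apply: leq_trans (card_size _) Sm.
- rewrite disjoint_subset; apply/subsetP => x; rewrite !inE => xS.
  apply: (@untouchedN l).
  case/verticesP: xS => c /(mem_subseq Sk) cl xc.
  by apply/verticesP; exists c.
have Xl := map_layout GS loc.
have [l' [Xl' full]] := layout_extend (fun w => leq_trans (hP.2 _ _ PX w) d2) Xl.
exists W, X, ([seq (c.1, map phi c.2) | c <- S] ++ l'); split => // t.
rewrite -Scnt map_cat count_cat; apply: leq_trans (leq_addr _ _).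
have shE : @comp_shape W \o (fun c => (c.1, map phi c.2)) =1 @comp_shape V.
  by move=> c; rewrite /comp_shape /= size_map.
by rewrite -map_comp (eq_map shE).
Qed.

Section Member.
Variables (W : finType) (X : graph W) (l0 : seq (bool * seq W)).
Hypotheses (Wn : #|W| = n) (PX : P X) (Xl0 : partial_layout X l0).
Hypothesis l0full : forall w, w \in vertices l0.
Hypothesis dom : forall t, minn s (count_mem t (map (@comp_shape _) k)) <=
  count_mem t (map (@comp_shape _) l0).

Let size_l0 : size (vertices l0) = n.
Proof. by rewrite size_uniq_full//; case: Xl0. Qed.

(** The new cycle is modelled on [c0] and the kept components on the short components of [X]. Up to
    [M] untouched components are merged as well, to make the cycle long enough. *)
Lemma long_component_close c0 : c0 \in l0 -> M < size c0.2 ->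
  exists2 H, P H & edit_distance G H <= 4 * (#|B| + M).
Proof.
move=> c0l c0M; pose k1 := drop M k; pose a1 := a ++ take M k.
have l1E : perm_eq l (k1 ++ a1).
  apply: perm_trans lE _; rewrite -{1}(cat_take_drop M k) /a1 -catA.
  by rewrite perm_sym perm_catC -catA perm_catCA perm_cat2l perm_catC.
have Gka1 := perm_partial_layout l1E Gl.
have ka1full x : x \in vertices (k1 ++ a1).
  by rewrite -(perm_mem (perm_vertices l1E)).
have a1large : M <= size (vertices a1).
  have [Mk|kM] := leqP M (size k).
    rewrite /a1 vertices_cat size_cat.
    apply: leq_trans (leq_addl _ _); rewrite -{1}(size_takel Mk).
    apply: size_vertices_ge; case: Gk => + _ _ => /allP h.
    by apply/allP => c /mem_take; apply: h.
  (* With fewer than [M] untouched components all of [G] is merged, and [n] exceeds [M] because [X]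
     contains [c0]. *)
  have -> : size (vertices a1) = size (vertices l).
    apply/esym/perm_size; rewrite (perm_trans (perm_vertices l1E))//.
    by rewrite /k1 drop_oversize// ltnW.
  rewrite size_uniq_full//; last by case: Gl.
  rewrite Vn -size_l0 (perm_size (perm_vertices (perm_to_rem c0l))).
  by rewrite vertices_cons size_cat; apply: leq_trans (leq_addr _ _); apply: ltnW.
have sa1 : size a1 <= #|B| + M.
  rewrite size_cat leq_add//; last by rewrite size_take; case: ltnP => // /ltnW.
  by rewrite size_filter touched_count.
have [|Pm ed] := merged_close Gka1 ka1full a1large; last first.
  exists (merged k1 a1) => //; apply: leq_trans ed _.
  by rewrite leq_mul2l.
move=> U Us.
have /card_gt0P[w0 _] : 0 < #|W| by rewrite Wn.
(* Untouched components have at most [M] vertices, so discarding the longer ones of [X] loses no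
   relevant shape and keeps the images away from [c0]. *)
pose L := filter (fun c : bool * seq W => size c.2 <= M) l0.
have LE : perm_eq l0 (L ++ filter (fun c : bool * seq W => ~~ (size c.2 <= M)) l0).
  by rewrite perm_sym; apply/permPl/perm_filterC.
have domL t : minn s (count_mem t (map (@comp_shape _) k1)) <=
    count_mem t (map (@comp_shape _) L).
  have k1k : subseq (map (@comp_shape _) k1) (map (@comp_shape _) k).
    by apply: map_subseq; apply: drop_subseq.
  have [tM|tM] := leqP t.2 M.
    apply: leq_trans (leq_trans (dom t) _).
      rewrite leq_min geq_minl /=; apply: leq_trans (geq_minr _ _) _.
      exact: leq_count_subseq.
    rewrite !count_map count_filter; apply: sub_count => c /= /eqP tE.
    by rewrite tE eqxx; move: tM; rewrite -tE.
  rewrite (_ : count_mem t _ = 0) ?minn0//; apply/eqP; rewrite -leqn0 leqNgt.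
  rewrite -has_count; apply/hasP => -[_ /(mem_subseq k1k) /mapP[c ck ->]].
  move=> /eqP tE; move: tM; rewrite -tE /= ltnNge => /negP; apply.
  exact: (allP size_untouched).
have [psi [locpsi psiL]] := touched_local_map w0
  (partial_layout_catl Gka1) (partial_layout_filter _ Xl0) domL Us.
have [|||phi [loc _]] :=
  merged_local_map Gka1 ka1full a1large w0 Us _ _ locpsi (q := c0.2).
- by apply: (@layout_segment _ _ l0 c0 [::] c0.2 [::]) => //; rewrite cats0.
- exact: ltnW.
- move=> x xU xk; apply/negP => xc0.
  have [_ + _] := perm_partial_layout LE Xl0.
  rewrite vertices_cat cat_uniq => /and3P[_ /hasPn/(_ (psi x)) + _].
  rewrite /= psiL// => h; suff : ~~ true by [].
  apply: h; apply/verticesP; exists c0 => //.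
  by rewrite mem_filter c0l -ltnNge c0M.
by exists W, X, phi.
Qed.

(** [close_vector] gives admissible counts [h] near the counts [g] of the untouched part, with [r]
    the number of vertices in touched components. Only the vertices outside the kept components are
    rearranged. *)
Lemma short_components_close : all (fun c => size c.2 <= M) l0 ->
  exists2 H, P H & edit_distance G H <= 2 * (2 * M * (M * M) + 2 * M * #|B|).
Proof.
move=> l0M.
have l0ne : all (fun c : bool * seq W => 0 < size c.2) l0 by case: Xl0.
have kne : all (fun c : bool * seq V => 0 < size c.2) k by case: Gk.
pose T := (bool * 'I_M)%type.
pose sz (t : T) := t.2.+1.
pose g (t : T) := count_mem (shape_of t) (map (@comp_shape _) k).
pose h0 (t : T) := count_mem (shape_of t) (map (@comp_shape _) l0).
have vk : size (vertices k) = \sum_t sz t * g t.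
  exact: size_vertices_shapes kne size_untouched.
have v0E : n = \sum_t sz t * h0 t.
  by rewrite -size_l0; apply: size_vertices_shapes.
have nE : n = size (vertices k) + size (vertices a).
  rewrite -Vn -(@size_uniq_full _ (vertices l))//; last by case: Gl.
  by rewrite (perm_size (perm_vertices lE)) vertices_cat size_cat.
have [|||h [hvol hdom hbd]] :=
    @close_vector T sz M s (size (vertices a)) g h0.
- by move=> t; rewrite /sz /= ltn_ord.
- by rewrite -v0E -vk.
- move=> t; have := dom (shape_of t); rewrite -/(g t) -/(h0 t).
  by lia.
have [e' e'E] := seq_of_counts h.
have [e eE] := seq_of_counts (fun t => h t - g t).
have cntM (u : seq T) t :
    count_mem (shape_of t) (map (@shape_of M) u) = count_mem t u.
  rewrite count_map; apply: eq_count => t' /=; exact: (inj_eq (@shape_of_inj M)).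
(* Of each shape, [minn (h t) (g t)] components of [G] survive; the missing [h t - g t] are cut out
   of the remaining vertices [rs]. *)
have [k1 k1k k1E] := capped_subseq (@comp_shape V)
  (fun t => count_mem t (map (@shape_of M) e')) k.
have Gk1 := partial_layout_subseq k1k Gk.
have k1M : all (fun c => size c.2 <= M) k1.
  by apply/allP => c /(mem_subseq k1k); apply: (allP size_untouched).
have [k1ne uk1 _] := Gk1.
pose rs := [seq x <- enum V | x \notin vertices k1].
have uk1rs : uniq (vertices k1 ++ rs).
  rewrite cat_uniq uk1 filter_uniq ?enum_uniq// andbT.
  by apply/hasPn => x; rewrite mem_filter => /andP[].
have vk1 : size (vertices k1) = \sum_t sz t * minn (h t) (g t).
  rewrite (size_vertices_shapes k1ne k1M); apply: eq_bigr => t _.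
  by rewrite k1E cntM e'E.
have rsE : size rs = \sum_t sz t * (h t - g t).
  have : size (vertices k1) + size rs = n.
    rewrite -Vn -size_cat; apply: size_uniq_full => // x.
    by rewrite mem_cat mem_filter mem_enum andbT orbN.
  have : \sum_t sz t * h t =
      \sum_t sz t * minn (h t) (g t) + \sum_t sz t * (h t - g t).
    rewrite -big_split; apply: eq_bigr => t _ /=.
    by rewrite -mulnDr; congr (_ * _); lia.
  by rewrite hvol -v0E vk1 => -> /addnI.
have [|fl flv fls] := @fill_shapes V (map (@shape_of M) e) rs.
  rewrite rsE -map_comp (eq_map (g := sz))// sumn_counts.
  by apply: eq_bigr => t _; rewrite eE.
have flM c : c \in fl -> 0 < size c.2 <= M.
  move=> cfl; have : comp_shape c \in map (@shape_of M) e.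
    by rewrite -fls map_f.
  by case/mapP => t _ [_ ->]; rewrite /= ltn_ord.
pose Hl := k1 ++ fl.
have HlM c : c \in Hl -> 0 < size c.2 <= M.
  rewrite mem_cat => /orP[ck|/flM//].
  by rewrite (allP k1ne _ ck) (allP k1M _ ck).
have Hlv : vertices Hl = vertices k1 ++ rs by rewrite vertices_cat flv.
have HHl : partial_layout (layout_graph Hl) Hl.
  apply: layout_graph_partial_layout; last by rewrite Hlv.
  by apply/allP => c /HlM /andP[].
have /card_gt0P[w0 _] : 0 < #|W| by rewrite Wn.
have PH : P (layout_graph Hl).
  apply: realised_property => U Us.
  have [|phi [loc _]] := touched_local_map w0 HHl Xl0 _ Us.
    (* The new graph has [h t] components of shape [t], and by [hdom] either [X] has as many or it
       has at least [s]. *)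
    move=> t; have [tM|tM] := boolP (0 < t.2 <= M).
      have [t' ->] : exists t' : T, t = shape_of t'.
        case/andP: tM => t0 tM; have tM' : t.2.-1 < M by lia.
        exists (t.1, Ordinal tM'); rewrite /shape_of /= prednK//.
        exact: surjective_pairing.
      rewrite map_cat count_cat k1E fls !cntM e'E eE.
      have := hdom t'; rewrite -/(g t') -/(h0 t'); lia.
    rewrite (_ : count_mem t (map (@comp_shape _) Hl) = 0) ?minn0//.
    apply/eqP; rewrite -leqn0 leqNgt -has_count; apply/hasP => -[_ /mapP[c cH ->]].
    by move=> /eqP tE; move: tM; rewrite -tE HlM.
  exists W, X, phi; split => //.
  apply: local_map_sub loc => //; apply/subsetP => x xU.
  rewrite inE xU Hlv mem_cat mem_filter mem_enum andbT; exact: orbN.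
exists (layout_graph Hl) => //.
have agree x y : x \notin [set x in rs] -> G x y = layout_graph Hl x y.
  rewrite inE mem_filter mem_enum andbT negbK => xk1.
  have [_ _ ->] := Gk1 => //.
  by have [_ _ ->] := partial_layout_catl HHl.
have := edit_distance_le dG (hP.2 _ _ PH) agree.
move=> /leq_trans; apply; apply: leq_mul => //.
apply: (@leq_trans (size rs)); first by rewrite cardsE card_size.
rewrite rsE; apply: leq_trans hbd _.
rewrite card_prod card_bool card_ord leq_add2l.
exact: size_vertices_touched.
Qed.

End Member.

End ShortSegments.

(** The constant dominates the bounds of the three cases; additive terms are absorbed since [B] is
    nonempty. *)
Lemma nearest_member : exists2 H, P H &
  edit_distance G H <= (12 + 12 * M + 4 * (M * (M * M))) * #|B|.
Proof.
have Gnil : partial_layout G [::] by split.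
have [l [Gl lfull]] := layout_extend dG2 Gnil.
have B0' := B0.
have [[c [p1 [q [p2 [cl cE qM qB]]]]]|none] :=
    pselect (exists c p1 q p2, [/\ c \in l, c.2 = p1 ++ q ++ p2,
      M <= size q & ~~ has (mem B) q]).
  have [H PH ed] := long_segment_close Gl lfull cl cE qM qB.
  by exists H => //; apply: leq_trans ed _; rewrite leq_mul2r; lia.
have short : {in l, forall c p1 q p2,
    c.2 = p1 ++ q ++ p2 -> M <= size q -> has (mem B) q}.
  move=> c cl p1 q p2 cE qM; apply: contrapT => /negP qB; apply: none.
  by exists c, p1, q, p2.
have [W [X [l0 [Wn PX Xl0 l0full dom]]]] := member_with_untouched Gl short.
have [l0M|] := boolP (all (fun c => size c.2 <= M) l0).
  have [H PH ed] := short_components_close Gl lfull short Wn PX Xl0 l0full dom l0M.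
  by exists H => //; apply: leq_trans ed _; nia.
case/allPn => c0 c0l; rewrite -ltnNge => c0M.
have [H PH ed] := long_component_close Gl lfull short Wn PX Xl0 l0full dom c0l c0M.
by exists H => //; apply: leq_trans ed _; nia.
Qed.

End NearestMember.

(** * Locality of the enlarged family and the choice of [tau] *)

Import Order.TTheory GRing.Theory Num.Theory.

Theorem theorem7p18 (R : realType) (d : nat) (hd : (d <= 2)%N)
    (P : graph_class) (hP : is_property d P) (hloc : GSF_local d P) :
  non_propagating R d P.
Proof.
have [Fbar [s0 loc]] := hloc.
pose s := maxn s0 d.+2; pose M := 2 * s + 2; pose m := 2 * M * (M * s).
pose C := 12 + 12 * M + 4 * (M * (M * M)).
have s0s : s0 <= s by apply: leq_maxl.
have sm : s <= m by rewrite /m /M; nia.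
(* Members avoid this family by definition. Conversely it contains every graph of [Fbar n], as these
   have at most [s0 <= m] vertices and embed into no member. *)
exists (fun n => unrealised P n m).
  exists m => n; split=> [F []//|V G Vn]; split=> [PG|[dG free]].
    by split=> [|F [_ unr]]; [apply: hP.2 PG|apply: unr PG].
  apply/((loc n).2 _ _ Vn); split => // F FF; apply: free; split.
    by apply: leq_trans ((loc n).1 _ FF) (leq_trans s0s sm).
  by move=> W X Wn /((loc n).2 _ _ Wn)[_ /(_ F FF)].
have C0 : (0 < C%:R :> R)%R by rewrite ltr0n.
(* Linear growth matches the bound [C * #|B|] on the edits, and the cap at 1 keeps values in the
   required range. *)
exists (fun x : R => Num.min 1 (C%:R * x))%R; split.
- move=> x /andP[x0 x1].
  by rewrite lt_min ge_min lexx ltr01 mulr_gt0.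
- move=> x y _ _ xy; rewrite le_min !ge_min lexx /=.
  by rewrite ler_pM2l// xy orbT.
- move=> eps eps0; exists (Num.min 1 (eps / (2 * C%:R)))%R.
    by rewrite lt_min ge_min lexx ltr01 divr_gt0// mulr_gt0.
  rewrite gt_min; apply/orP; right.
  apply: (@le_lt_trans _ _ (C%:R * (eps / (2 * C%:R)))%R).
    by rewrite ler_pM2l// ge_min lexx orbT.
  have -> : (C%:R * (eps / (2 * C%:R)) = eps / 2)%R by field; rewrite gt_eqF.
  by lra.
move=> n V G Vn dG B cov; left.
(* If [B] is empty, covering says that [G] itself is free, at distance zero. *)
have [B0|[v vB]] := set_0Vmem B.
  exists G.
    split=> // F FF [f /(cov _ FF)[x]]; by rewrite B0 inE.
  rewrite B0 cards0 mul0r mulr0 /edit_distance setDv setU0 cards0.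
  by rewrite min_r ?mul0r.
have n0 : (0 < n%:R :> R)%R by rewrite ltr0n -Vn; apply/card_gt0P; exists v.
have [H PH ed] := nearest_member hP hd (leq_maxr s0 d.+2)
  (fun F FF => leq_trans ((loc n).1 F FF) s0s) (loc n).2 Vn dG cov vB.
have dH := hP.2 _ _ PH.
exists H.
  by split=> // F [_ unr]; apply: unr PH.
(* The degree bounds alone give [d * n], which settles the case where [tau] equals 1. *)
have edn : edit_distance G H <= d * n.
  rewrite -Vn -cardsT; apply: edit_distance_le => // x y; by rewrite inE.
rewrite Vn minEle; case: ifP => _.
  by rewrite mul1r -natrM ler_nat.
have -> : (C%:R * (#|B|%:R / n%:R) * d%:R * n%:R = (d * (C * #|B|))%:R :> R)%R.
  by rewrite !natrM; field; rewrite gt_eqF.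
(* The bound [C * #|B|] carries no factor [d]: for [d = 0] the distance vanishes, and otherwise the
   factor [d] only enlarges the bound. *)
rewrite ler_nat; case: (posnP d) => [d0|d0].
  by move: edn; rewrite d0 !mul0n.
by apply: leq_trans ed _; rewrite -/M -/C leq_pmull.
Qed.
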